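(* Over a field $\Bbbk$, there are natural equivalences between the following categories: (1) the category of finite dimensional, not necessarily unital, (associative) $\Bbbk$-algebras; (2) the category of 2-unitary operads of GKdimension $\le2$; (3) the category of $2a$-unitary operads of GKdimension $\le2$.
   Context: Fix a field $\Bbbk$; all operads are $\Bbbk$-linear symmetric operads (right $\mathbb S_n$-action on $\mathcal P(n)$, identity $\mathbf 1\in\mathcal P(1)$, compositions $\theta\circ(\theta_1,\dots,\theta_n)$ with the usual unit, associativity and equivariance axioms). $\mathcal P$ is unitary if $\mathcal P(0)=\Bbbk\mathbf 1_0\cong\Bbbk$. A 2-unitary operad is a triple $(\mathcal P,\mathbf 1_0,\mathbf 1_2)$ with $\mathcal P$ unitary, $\mathbf 1_0$ a basis of $\mathcal P(0)$, and $\mathbf 1_2\in\mathcal P(2)$ satisfying $\mathbf 1_2\circ(\mathbf 1_0,\mathbf 1)=\mathbf 1=\mathbf 1_2\circ(\mathbf 1,\mathbf 1_0)$. It is $2a$-unitary if moreover $\mathbf 1_2\circ(\mathbf 1_2,\mathbf 1)=\mathbf 1_2\circ(\mathbf 1,\mathbf 1_2)$. A morphism of 2-unitary (or $2a$-unitary) operads is a morphism of operads preserving $\mathbf 1_0$ and $\mathbf 1_2$. $\operatorname{GKdim}\mathcal P=\limsup_{n\to\infty}\log_n\big(\sum_{i=0}^n\dim_\Bbbk\mathcal P(i)\big)$; when GKdimension is discussed, $\mathcal P$ is implicitly assumed locally finite ($\dim_\Bbbk\mathcal P(n)<\infty$ for all $n$). *)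

(* Defs.v *)
From HB Require Import structures.
From mathcomp Require Import all_boot all_order all_fingroup all_algebra.
From mathcomp Require Import boolp reals constructive_ereal ereal sequences exp.

Set Implicit Arguments.
Unset Strict Implicit.
Unset Printing Implicit Defensive.

Import GRing.Theory.

Local Open Scope ring_scope.

Record category := Category {
  ob :> Type;
  hom : ob -> ob -> Type;
  idm : forall X, hom X X;
  compm : forall X Y Z, hom Y Z -> hom X Y -> hom X Z;
  compm1 : forall X Y (f : hom X Y), compm f (idm X) = f;
  comp1m : forall X Y (f : hom X Y), compm (idm Y) f = f;
  compmA : forall X Y Z W (h : hom Z W) (g : hom Y Z) (f : hom X Y),
    compm h (compm g f) = compm (compm h g) f }.

Arguments hom {c}.
Arguments idm {c}.
Arguments compm {c X Y Z}.

Record functor (C D : category) := Functor {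
  fob :> C -> D;
  fmap : forall X Y, hom X Y -> hom (fob X) (fob Y);
  fmap1 : forall X, fmap (idm X) = idm (fob X);
  fmapM : forall X Y Z (g : hom Y Z) (f : hom X Y),
    fmap (compm g f) = compm (fmap g) (fmap f) }.

Arguments fmap {C D} _ {X Y}.

Definition functor_id (C : category) : functor C C :=
  @Functor C C id (fun _ _ f => f) (fun _ => erefl) (fun _ _ _ _ _ => erefl).

Section FunctorComp.
Variables (C D E : category) (G : functor D E) (F : functor C D).

Lemma functor_comp1 (X : C) : fmap G (fmap F (idm X)) = idm (G (F X)).
Proof. by rewrite !fmap1. Qed.

Lemma functor_compM (X Y Z : C) (g : hom Y Z) (f : hom X Y) :
  fmap G (fmap F (compm g f)) =
  compm (fmap G (fmap F g)) (fmap G (fmap F f)).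
Proof. by rewrite !fmapM. Qed.

Definition functor_comp : functor C E := Functor functor_comp1 functor_compM.

End FunctorComp.

Definition is_iso (C : category) (X Y : C) (f : hom X Y) : Prop :=
  exists g : hom Y X, compm g f = idm X /\ compm f g = idm Y.

Definition nat_isomorphic (C D : category) (F G : functor C D) : Prop :=
  exists eta : forall X, hom (F X) (G X),
    (forall X Y (f : hom X Y),
       compm (fmap G f) (eta X) = compm (eta Y) (fmap F f)) /\
    (forall X, is_iso (eta X)).

Definition is_equivalence (C D : category) (F : functor C D) : Prop :=
  exists G : functor D C,
    nat_isomorphic (functor_comp G F) (functor_id C) /\
    nat_isomorphic (functor_comp F G) (functor_id D).

Section FullSubcategory.
Variable C : category.

Definition full_sub (p : C -> Prop) : category :=
  @Category {X : C | p X} (fun X Y => hom (sval X) (sval Y))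
    (fun X => idm (sval X)) (fun X Y Z g f => compm g f)
    (fun X Y f => compm1 f) (fun X Y f => comp1m f)
    (fun X Y Z W h g f => compmA h g f).

Definition full_incl (p : C -> Prop) : functor (full_sub p) C :=
  @Functor (full_sub p) C sval (fun _ _ f => f)
    (fun _ => erefl) (fun _ _ _ _ _ => erefl).

Definition full_incl_sub (p q : C -> Prop) (pq : forall X, p X -> q X) :
    functor (full_sub p) (full_sub q) :=
  @Functor (full_sub p) (full_sub q)
    (fun X => exist q (sval X) (pq _ (svalP X))) (fun _ _ f => f)
    (fun _ => erefl) (fun _ _ _ _ _ => erefl).

End FullSubcategory.

Section Algebras.
Variable K : fieldType.

Record fdalg := FdAlg {
  fa_sort :> vectType K;
  fa_mul : fa_sort -> fa_sort -> fa_sort;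
  fa_linl : forall y, linear (fun x => fa_mul x y);
  fa_linr : forall x, linear (fun y => fa_mul x y);
  fa_mulA : associative fa_mul }.

Record fdalg_hom (A B : fdalg) := FdAlgHom {
  fh_fun :> 'Hom(A, B);
  fh_mul : forall x y, fh_fun (fa_mul x y) = fa_mul (fh_fun x) (fh_fun y) }.

Lemma fdalg_hom_eq (A B : fdalg) (f g : fdalg_hom A B) :
  fh_fun f = fh_fun g -> f = g.
Proof.
case: f g => [f fM] [g gM] /= fg; case: _ / fg gM => gM.
by congr FdAlgHom; exact: Prop_irrelevance.
Qed.

Lemma fdalg_id_mul (A : fdalg) (x y : A) :
  (\1%VF : 'End(A)) (fa_mul x y) = fa_mul ((\1 : 'End(A))%VF x) ((\1 : 'End(A))%VF y).
Proof. by rewrite !id_lfunE. Qed.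

Lemma fdalg_comp_mul (A B C : fdalg) (g : fdalg_hom B C) (f : fdalg_hom A B) x y :
  (g \o f)%VF (fa_mul x y) = fa_mul ((g \o f)%VF x) ((g \o f)%VF y).
Proof. by rewrite !comp_lfunE !fh_mul. Qed.

Definition fdalg_id A := FdAlgHom (@fdalg_id_mul A).
Definition fdalg_comp A B C g f := FdAlgHom (@fdalg_comp_mul A B C g f).

Lemma fdalg_comp1 A B (f : fdalg_hom A B) : fdalg_comp f (fdalg_id A) = f.
Proof. by apply: fdalg_hom_eq; rewrite /= comp_lfun1r. Qed.

Lemma fdalg_1comp A B (f : fdalg_hom A B) : fdalg_comp (fdalg_id B) f = f.
Proof. by apply: fdalg_hom_eq; rewrite /= comp_lfun1l. Qed.

Lemma fdalg_compA A B C D (h : fdalg_hom C D) (g : fdalg_hom B C)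
    (f : fdalg_hom A B) :
  fdalg_comp h (fdalg_comp g f) = fdalg_comp (fdalg_comp h g) f.
Proof. by apply: fdalg_hom_eq; rewrite /= comp_lfunA. Qed.

Definition FdAlgCat : category := Category fdalg_comp1 fdalg_1comp fdalg_compA.

End Algebras.

(* The positions of \sum_i k i are the pairs (i, j) with j < k i in
   lexicographic order; [tagnat.sig1], [tagnat.sig2] and [tagnat.Rank] of
   order.v are the two coordinates and the inverse of this numbering. *)

Section BlockPermutations.
Variables (n : nat) (k : 'I_n -> nat).

Section Sum.
Variable t : forall i, 'S_(k i).

Definition sum_perm_fun (q : 'I_(\sum_i k i)) : 'I_(\sum_i k i) :=
  tagnat.Rank (tagnat.sig1 q) (t _ (tagnat.sig2 q)).

Lemma sum_perm_inj : injective sum_perm_fun.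
Proof.
move=> p q; rewrite /sum_perm_fun => /tagnat.rank_inj e.
apply: tagnat.sig_inj; rewrite !tagnat.sigE12.
move: (tagnat.sig1 p) (tagnat.sig2 p) (tagnat.sig1 q) (tagnat.sig2 q) e.
move=> i a i' b e; have /= ii' := congr1 tag e.
case: _ / ii' b e => b e; congr existT; apply: (@perm_inj _ (t i)).
by move/eqP: e; rewrite eq_Tagged => /eqP.
Qed.

Definition sum_perm : 'S_(\sum_i k i) := perm sum_perm_inj.

End Sum.

Section Block.
Variable s : 'S_n.

Lemma block_size : (\sum_i k i = \sum_i k (s i))%N.
Proof. exact: (reindex_inj (@perm_inj _ s)). Qed.

Definition block_perm_fun (q : 'I_(\sum_i k i)) : 'I_(\sum_i k i) :=
  let q' := cast_ord block_size q in
  tagnat.Rank (s (tagnat.sig1 q')) (tagnat.sig2 q').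

Lemma block_perm_inj : injective block_perm_fun.
Proof.
move=> p q; rewrite /block_perm_fun => /tagnat.rank_inj e.
apply: (@cast_ord_inj _ _ block_size).
move: (cast_ord _ p) (cast_ord _ q) e => {}p {}q e.
apply: tagnat.sig_inj; rewrite !tagnat.sigE12.
move: (tagnat.sig1 p) (tagnat.sig2 p) (tagnat.sig1 q) (tagnat.sig2 q) e.
move=> i a i' b e; have /= /perm_inj ii' := congr1 tag e.
case: _ / ii' b e => b e; congr existT.
by move/eqP: e; rewrite eq_Tagged => /eqP.
Qed.

(* The permutation of n consecutive blocks, of sizes k (s 0), k (s 1), ...,
   which sends the i-th block to the (s i)-th one, preserving the order inside
   each block; in the target layout the sizes are k 0, k 1, ... *)
Definition block_perm : 'S_(\sum_i k i) := perm block_perm_inj.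

End Block.
End BlockPermutations.

Section Operads.
Variable K : fieldType.

(* Equality of two operations whose arities are equal, but not convertible. *)
Definition heq (P : nat -> vectType K) m n (x : P m) (y : P n) : Prop :=
  existT (fun n => P n : Type) m x = existT (fun n => P n : Type) n y.
Arguments heq P {m n}.

(* The spaces P(n) are [vectType]s, so operads are locally finite by
   definition.

   Products of permutations: (s * t)%g is t \o s in MathComp, so that
   [op_actM] below says (x.s).t = x.(s \o t), i.e. the action is a right action
   for the usual composition of permutations.

   [op_equiv_out] is
     (x.s) o (y_1, ..., y_n)
       = (x o (y_(s^-1 1), ..., y_(s^-1 n))) . s_(k_1, ..., k_n)
   after the substitution y_i := y_(s i). *)
Record operad := Operad {
  op_sort :> nat -> vectType K;
  op_act : forall n, op_sort n -> 'S_n -> op_sort n;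
  op_one : op_sort 1%N;
  op_comp : forall n (k : 'I_n -> nat),
    op_sort n -> (forall i, op_sort (k i)) -> op_sort (\sum_i k i)%N;
  op_act_linear : forall n (s : 'S_n), linear (fun x => op_act x s);
  op_act1 : forall n (x : op_sort n), op_act x 1%g = x;
  op_actM : forall n (s t : 'S_n) (x : op_sort n),
    op_act (op_act x s) t = op_act x (t * s)%g;
  op_comp_linl : forall n (k : 'I_n -> nat) (y : forall i, op_sort (k i)),
    linear (fun x : op_sort n => op_comp x y);
  op_comp_linr : forall n (k : 'I_n -> nat) (x : op_sort n)
      (y : forall i, op_sort (k i)) (i : 'I_n),
    linear (fun z : op_sort (k i) => op_comp x (dfwith y z));
  op_comp1 : forall n (x : op_sort n),
    heq op_sort (op_comp x (fun _ : 'I_n => op_one)) x;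
  op_1comp : forall n (x : op_sort n),
    heq op_sort (op_comp op_one (fun _ : 'I_1 => x)) x;
  op_compA : forall n (k : 'I_n -> nat) (l : forall i, 'I_(k i) -> nat)
      (x : op_sort n) (y : forall i, op_sort (k i))
      (z : forall i (j : 'I_(k i)), op_sort (l i j)),
    heq op_sort
      (op_comp x (fun i => op_comp (y i) (z i)))
      (op_comp (op_comp x y) (fun q => z (tagnat.sig1 q) (tagnat.sig2 q)));
  op_equiv_in : forall n (k : 'I_n -> nat) (t : forall i, 'S_(k i))
      (x : op_sort n) (y : forall i, op_sort (k i)),
    op_comp x (fun i => op_act (y i) (t i)) =
    op_act (op_comp x y) (sum_perm t);
  op_equiv_out : forall n (k : 'I_n -> nat) (s : 'S_n)
      (x : op_sort n) (y : forall i, op_sort (k i)),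
    heq op_sort
      (op_comp (op_act x s) (fun i => y (s i)))
      (op_act (op_comp x y) (block_perm k s)) }.

Arguments op_act {o n}.
Arguments op_one {o}.
Arguments op_comp {o n k}.

Definition comp2 (P : operad) p q (x : P 2%N) (a : P p) (b : P q) :=
  op_comp x (fun i : 'I_2 =>
    if i == ord0 as c return P (if c then p else q) then a else b).

Record operad2u := Operad2u {
  tu_operad :> operad;
  tu_0 : tu_operad 0%N;
  tu_2 : tu_operad 2%N;
  tu_0_basis : basis_of {:tu_operad 0%N} [:: tu_0];
  tu_2l : heq tu_operad (comp2 tu_2 tu_0 op_one) (@op_one tu_operad);
  tu_2r : heq tu_operad (comp2 tu_2 op_one tu_0) (@op_one tu_operad) }.

Definition is_2a_unitary (P : operad2u) : Prop :=
  heq P (comp2 (tu_2 P) (tu_2 P) op_one) (comp2 (tu_2 P) op_one (tu_2 P)).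

Record operad2u_hom (P Q : operad2u) := Operad2uHom {
  oh_fun :> forall n, 'Hom(P n, Q n);
  oh_act : forall n (x : P n) (s : 'S_n),
    oh_fun n (op_act x s) = op_act (oh_fun n x) s;
  oh_one : oh_fun 1%N op_one = op_one;
  oh_comp : forall n (k : 'I_n -> nat) (x : P n) (y : forall i, P (k i)),
    oh_fun _ (op_comp x y) = op_comp (oh_fun n x) (fun i => oh_fun _ (y i));
  oh_0 : oh_fun 0%N (tu_0 P) = tu_0 Q;
  oh_2 : oh_fun 2%N (tu_2 P) = tu_2 Q }.

Lemma operad2u_hom_eq (P Q : operad2u) (f g : operad2u_hom P Q) :
  (forall n, f n = g n) -> f = g.
Proof.
case: f g => [f f1 f2 f3 f4 f5] [g g1 g2 g3 g4 g5] /= fg.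
have {}fg : f = g by exact: functional_extensionality_dep.
case: _ / fg g1 g2 g3 g4 g5 => g1 g2 g3 g4 g5.
by congr Operad2uHom; exact: Prop_irrelevance.
Qed.

Program Definition operad2u_id (P : operad2u) : operad2u_hom P P :=
  @Operad2uHom P P (fun n => \1%VF) _ _ _ _ _.
Next Obligation. by move=> P n x s; rewrite !id_lfunE. Qed.
Next Obligation. by move=> P; rewrite id_lfunE. Qed.
Next Obligation.
move=> P n k x y; rewrite !id_lfunE; congr op_comp.
by apply: functional_extensionality_dep => i; rewrite id_lfunE.
Qed.
Next Obligation. by move=> P; rewrite id_lfunE. Qed.
Next Obligation. by move=> P; rewrite id_lfunE. Qed.

Program Definition operad2u_comp (P Q S : operad2u)
    (g : operad2u_hom Q S) (f : operad2u_hom P Q) : operad2u_hom P S :=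
  @Operad2uHom P S (fun n => (g n \o f n)%VF) _ _ _ _ _.
Next Obligation. by move=> P Q S g f n x s; rewrite !comp_lfunE !oh_act. Qed.
Next Obligation. by move=> P Q S g f; rewrite comp_lfunE !oh_one. Qed.
Next Obligation.
move=> P Q S g f n k x y; rewrite !comp_lfunE !oh_comp; congr op_comp.
by apply: functional_extensionality_dep => i; rewrite comp_lfunE.
Qed.
Next Obligation. by move=> P Q S g f; rewrite comp_lfunE !oh_0. Qed.
Next Obligation. by move=> P Q S g f; rewrite comp_lfunE !oh_2. Qed.

Lemma operad2u_comp1 P Q (f : operad2u_hom P Q) :
  operad2u_comp f (operad2u_id P) = f.
Proof. by apply: operad2u_hom_eq => n; rewrite /= comp_lfun1r. Qed.

Lemma operad2u_1comp P Q (f : operad2u_hom P Q) :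
  operad2u_comp (operad2u_id Q) f = f.
Proof. by apply: operad2u_hom_eq => n; rewrite /= comp_lfun1l. Qed.

Lemma operad2u_compA P Q S T (h : operad2u_hom S T) (g : operad2u_hom Q S)
    (f : operad2u_hom P Q) :
  operad2u_comp h (operad2u_comp g f) = operad2u_comp (operad2u_comp h g) f.
Proof. by apply: operad2u_hom_eq => n; rewrite /= comp_lfunA. Qed.

Definition Op2uCat : category :=
  Category operad2u_comp1 operad2u_1comp operad2u_compA.

(* The terms n = 0, 1, where log_n is not defined, do not affect the limsup. *)
Definition GKdim (R : realType) (P : operad) : \bar R :=
  limn_esup (fun n =>
    (ln (\sum_(i < n.+1) \dim {:P i})%N%:R / ln n%:R)%:E).

Definition Op2u_GK2 (R : realType) : category :=
  @full_sub Op2uCat (fun P => (GKdim R (P : operad2u) <= 2%:E)%E).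

Definition Op2a_GK2 (R : realType) : category :=
  @full_sub Op2uCat (fun P =>
    is_2a_unitary P /\ (GKdim R (P : operad2u) <= 2%:E)%E).

Definition forget_2a (R : realType) : functor (Op2a_GK2 R) (Op2u_GK2 R) :=
  full_incl_sub (fun _ => @proj2 _ _).

Definition ucomp (P : operad) n (x : P 1%N) (b : P n) : P n :=
  ecast m (P m) (big_ord1 _ (fun=> n)) (op_comp x (fun _ : 'I_1 => b)).

Lemma heq_eq (P : operad) n (x y : P n) : heq P x y -> x = y.
Proof. exact: eq_from_Tagged. Qed.

Lemma heq_ecast (P : operad) m n (e : m = n) (x : P m) :
  heq P (ecast m (P m) e x) x.
Proof. by case: _ / e. Qed.

Lemma heq_ucomp (P : operad) n (x : P 1%N) (b : P n) :
  heq P (ucomp x b) (op_comp x (fun _ : 'I_1 => b)).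
Proof. exact: heq_ecast. Qed.

Lemma heq_comp_const (P : operad) m n (x : P 1%N) (a : P m) (b : P n) :
  heq P a b ->
  heq P (op_comp x (fun _ : 'I_1 => a)) (op_comp x (fun _ : 'I_1 => b)).
Proof.
move=> e; have mn : m = n by exact: (congr1 tag e).
by case: _ / mn b e => b /heq_eq ->.
Qed.

Lemma heq_comp_constl (P : operad) m m' n (x : P m) (x' : P m') (z : P n) :
  heq P x x' ->
  heq P (op_comp x (fun _ : 'I_m => z)) (op_comp x' (fun _ : 'I_m' => z)).
Proof.
move=> e; have mm' : m = m' by exact: (congr1 tag e).
by case: _ / mm' x' e => x' /heq_eq ->.
Qed.

Lemma ucompA (P : operad) n (x y : P 1%N) (z : P n) :
  ucomp x (ucomp y z) = ucomp (ucomp x y) z.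
Proof.
apply: heq_eq; apply: (etrans (heq_ucomp _ _)).
apply: (etrans (heq_comp_const x (heq_ucomp y z))).
apply: (etrans (op_compA x (fun _ : 'I_1 => y) (fun _ _ => z))).
apply: esym; apply: (etrans (heq_ucomp _ _)).
exact/heq_comp_constl/heq_ucomp.
Qed.

Lemma linear_ecast (P : operad) (V : lmodType K) m n (e : m = n) (f : V -> P m) :
  linear f -> linear (fun x => ecast n (P n) e (f x)).
Proof. by case: _ / e. Qed.

Lemma ucomp_linl (P : operad) n (b : P n) : linear (fun x : P 1%N => ucomp x b).
Proof. exact/linear_ecast/op_comp_linl. Qed.

Lemma ucomp_linr (P : operad) n (x : P 1%N) : linear (fun b : P n => ucomp x b).
Proof.
apply: linear_ecast => a u v.
have dfE (w : P n) : dfwith (fun _ : 'I_1 => 0 : P n) (i := ord0) w = fun=> w.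
  by apply: functional_extensionality_dep => i; rewrite (ord1 i) dfwith_in.
by have := @op_comp_linr P 1 (fun=> n) x (fun=> 0) ord0 a u v; rewrite !dfE.
Qed.

Section Augmentation.
Variable P : operad2u.

Definition aug_fun (x : P 1%N) : P 0%N := ucomp x (tu_0 P).

HB.instance Definition _ :=
  GRing.isLinear.Build K (P 1%N) (P 0%N) _ aug_fun (@ucomp_linl P 0 (tu_0 P)).

Definition aug_ideal : {vspace P 1%N} := lker (linfun aug_fun).

Definition aug_mul (x y : subvs_of aug_ideal) : subvs_of aug_ideal :=
  vsproj aug_ideal (ucomp (vsval x) (vsval y)).

Lemma ucomp0 n (x : P 1%N) : ucomp x (0 : P n) = 0.
Proof.
have /= := ucomp_linr x 1 (0 : P n) 0.
by rewrite !scale1r addr0 -[X in X = _ -> _]addr0 => /addrI.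
Qed.

Lemma ucomp_aug (x y : P 1%N) : y \in aug_ideal -> ucomp x y \in aug_ideal.
Proof.
rewrite !memv_ker !lfunE /= /aug_fun -ucompA => /eqP ->.
by rewrite ucomp0.
Qed.

(* The ideal is closed under composition, so [vsproj] in [aug_mul] does not
   change the value. *)
Lemma aug_mulE (x y : subvs_of aug_ideal) :
  vsval (aug_mul x y) = ucomp (vsval x) (vsval y).
Proof. by rewrite vsprojK// ucomp_aug// subvsP. Qed.

Lemma aug_linl (y : subvs_of aug_ideal) : linear (fun x => aug_mul x y).
Proof.
move=> a u v; apply: subvs_inj.
by rewrite aug_mulE [in LHS]linearP ucomp_linl linearP/= !aug_mulE.
Qed.

Lemma aug_linr (x : subvs_of aug_ideal) : linear (fun y => aug_mul x y).
Proof.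
move=> a u v; apply: subvs_inj.
by rewrite aug_mulE [in LHS]linearP ucomp_linr linearP/= !aug_mulE.
Qed.

Lemma aug_mulA : associative aug_mul.
Proof. by move=> x y z; apply: subvs_inj; rewrite !aug_mulE ucompA. Qed.

Definition aug_alg : fdalg K := FdAlg aug_linl aug_linr aug_mulA.

End Augmentation.

Section AugmentationMorphism.
Variables (P Q : operad2u) (f : operad2u_hom P Q).

Lemma oh_heq m n (x : P m) (y : P n) :
  heq P x y -> heq Q (f m x) (f n y).
Proof.
move=> e; have mn : m = n by exact: (congr1 tag e).
by case: _ / mn y e => y /heq_eq ->.
Qed.

Lemma oh_ucomp n (x : P 1%N) (b : P n) :
  f n (ucomp x b) = ucomp (f _ x) (f _ b).
Proof.
apply: heq_eq; apply: (etrans (oh_heq (heq_ucomp _ _))).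
by rewrite oh_comp; apply: esym; exact: heq_ucomp.
Qed.

Lemma oh_aug (x : P 1%N) : x \in aug_ideal P -> f 1%N x \in aug_ideal Q.
Proof.
rewrite !memv_ker !lfunE /= /aug_fun => /eqP xP.
by rewrite -(oh_0 f) -oh_ucomp xP linear0.
Qed.

Definition aug_lfun : 'Hom(aug_alg P, aug_alg Q) :=
  (linfun (vsproj (aug_ideal Q)) \o f 1%N \o linfun (@vsval _ _ (aug_ideal P)))%VF.

Lemma aug_lfunE (x : aug_alg P) : vsval (aug_lfun x) = f 1%N (vsval x).
Proof. by rewrite !comp_lfunE !lfunE /= vsprojK// oh_aug// subvsP. Qed.

Lemma aug_lfun_mul (x y : aug_alg P) :
  aug_lfun (fa_mul x y) = fa_mul (aug_lfun x) (aug_lfun y).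
Proof.
by apply: subvs_inj; rewrite aug_lfunE !aug_mulE !aug_lfunE oh_ucomp.
Qed.

Definition aug_hom : fdalg_hom (aug_alg P) (aug_alg Q) := FdAlgHom aug_lfun_mul.

End AugmentationMorphism.

Lemma aug_hom1 P : aug_hom (operad2u_id P) = fdalg_id (aug_alg P).
Proof.
apply: fdalg_hom_eq; apply/lfunP => x; apply: subvs_inj.
by rewrite aug_lfunE !id_lfunE.
Qed.

Lemma aug_homM P Q S (g : operad2u_hom Q S) (f : operad2u_hom P Q) :
  aug_hom (operad2u_comp g f) = fdalg_comp (aug_hom g) (aug_hom f).
Proof.
apply: fdalg_hom_eq; apply/lfunP => x; apply: subvs_inj.
by rewrite aug_lfunE [in RHS]comp_lfunE !aug_lfunE comp_lfunE.
Qed.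

(* P |-> ker (P(1) -> P(0), x |-> x o 1_0), with product the composition of
   P(1) *)
Definition aug_functor : functor Op2uCat (FdAlgCat K) :=
  @Functor Op2uCat (FdAlgCat K) aug_alg aug_hom aug_hom1 aug_homM.

Definition aug_2u (R : realType) : functor (Op2u_GK2 R) (FdAlgCat K) :=
  functor_comp aug_functor (full_incl _).

Definition aug_2a (R : realType) : functor (Op2a_GK2 R) (FdAlgCat K) :=
  functor_comp aug_functor (full_incl _).

End Operads.

(* Main.v *)
From HB Require Import structures.
From mathcomp Require Import all_boot all_order all_fingroup all_algebra.
From mathcomp Require Import boolp classical_sets topology ereal constructive_ereal reals.
From mathcomp Require Import sequences exp zify lra.
Require Import Defs.

(** Let P be a 2-unitary operad, and A the kernel of x |-> x o 1_0 on P(1).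
Plugging 1_0 into every input of x in P(n) gives a scalar [eps x]; plugging it
into every input but the j-th gives [rho x j] in P(1), and rho x j - eps x * 1
lies in A.  So x has coordinates in K x A^n.  The coordinates of a composite
x o (y_1, ..., y_n) depend only on those of x and of the y_i, because all the
y_(i') with i' <> i become scalars when every input outside y_i is plugged:

  eps (x o y) = eps x * prod_i eps y_i,
  rho (x o y) (i, j) = (prod_(i' <> i) eps y_(i')) * (rho x i o rho y_i j).

These formulas make sense for an arbitrary algebra A, and define the operad
[algop A] with algop A (n) = K x A^n.  Its dimensions 1 + n dim A give
GKdim <= 2, its augmentation ideal is A again ([aug_algop_iso]), and taking
coordinates is a morphism P -> algop (aug_alg P), natural in P
([coords_natural]).  It remains to see that this morphism is bijective when
GKdim P <= 2; then A |-> algop A is quasi-inverse to the augmentation ideal.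

It is always onto ([coords_surj]): if u is a product of n factors built from
1_2, then u o (1 + a_1, ..., 1 + a_n) has coordinates (1; a_1, ..., a_n).

It is injective under the growth bound ([coords_inj]).  Otherwise, take x <> 0
of least arity with all coordinates zero.  The arity is at least 2, and
plugging 1_0 into any single input kills x, by minimality.  In particular x
dies under the deletion of its first and of its last input.  Such elements
propagate: x o (1_2, 1, ..., 1) - 1_2 o (1, x) is again a nonzero element of
this kind, of arity one more ([ker_both_neq0]).  Both deletions
are split surjections, by x |-> 1_2 o (x, 1) and x |-> 1_2 o (1, x), so the
kernels of the deletion of the last input have dimensions growing at least
linearly, dim P(n) grows at least quadratically, and the sums of the dimensions
grow at least like n^3, which contradicts GKdim P <= 2 ([GK2_ker_both]).

Finally algop A is 2a-unitary, and injectivity of the coordinates carries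
the associativity of 1_2 back to P ([ker_both0_2a]): the two categories of
operads have the same objects. *)

Set Implicit Arguments.
Unset Strict Implicit.
Unset Printing Implicit Defensive.

Import Order.TTheory GRing.Theory Num.Theory.
Local Open Scope ring_scope.

Arguments op_one {K o}.
Arguments heq {K} P {m n}.

(** * Composition in the total space of an operad *)

Section TotalSpace.
Variables (K : fieldType) (P : operad K).

(** Arities of composites are sums that equal the expected arity without being
convertible to it.  Equations between composites are therefore stated in the
total space, where they are plain equalities. *)
Definition anyop : Type := {n : nat & P n}.

Definition pack n (x : P n) : anyop := Tagged (fun n => P n : Type) x.

(** Since the arities of the arguments are read off from [y], the arguments form an
ordinary function, to which extensionality and rewriting apply. *)
Definition fcomp n (x : P n) (y : 'I_n -> anyop) : anyop :=
  pack (op_comp x (fun i => tagged (y i))).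

Lemma fcompA n (x : P n) (y : 'I_n -> anyop) (z : forall i, 'I_(tag (y i)) -> anyop) :
  fcomp x (fun i => fcomp (tagged (y i)) (z i)) =
  fcomp (tagged (fcomp x y)) (fun q => z (tagnat.sig1 q) (tagnat.sig2 q)).
Proof. exact: op_compA. Qed.

Lemma fcompx1 n (x : P n) : fcomp x (fun=> pack op_one) = pack x.
Proof. exact: op_comp1. Qed.

Lemma fcomp1x (x : anyop) : fcomp op_one (fun=> x) = x.
Proof. by case: x => n x; exact: op_1comp. Qed.

Lemma pack_tagged (s : anyop) : pack (tagged s) = s. Proof. by case: s. Qed.

(** Composites with an explicit list of arguments; the default value only matters
when the list is too short. *)
Definition lcomp (s : anyop) (ys : seq anyop) : anyop :=
  fcomp (tagged s) (fun i => nth (pack op_one) ys i).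

Lemma tag_lcomp s ys : size ys = tag s ->
  tag (lcomp s ys) = sumn [seq tag y | y <- ys].
Proof.
move=> sz; rewrite /= sumnE big_map (big_nth (pack op_one)) big_mkord.
by rewrite sz.
Qed.

Lemma lcompx1 s : lcomp s (nseq (tag s) (pack op_one)) = s.
Proof.
rewrite -[RHS]pack_tagged -[RHS]fcompx1; congr fcomp; apply/funext => i.
by rewrite nth_nseq ltn_ord.
Qed.

Lemma lcomp1x s : lcomp (pack op_one) [:: s] = s.
Proof.
by rewrite -[RHS]fcomp1x; congr fcomp; apply/funext => i; rewrite ord1.
Qed.

(** Both numberings of the positions of a concatenation are lexicographic, so that
associativity of composition can be stated with [flatten]. *)
Lemma nth_flatten_rank n (k : 'I_n -> nat) (T : Type) (x0 : T)
    (xss : seq (seq T)) (q : 'I_(\sum_i k i)) :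
  size xss = n -> (forall i : 'I_n, size (nth [::] xss i) = k i) ->
  nth x0 (flatten xss) q =
  nth x0 (nth [::] xss (tagnat.sig1 q)) (tagnat.sig2 q).
Proof.
move=> szx shx.
have nthsh (i : 'I_n) : nth 0%N (shape xss) i = k i.
  by rewrite (nth_map [::]) ?szx.
have qE : nat_of_ord q =
    flatten_index (shape xss) (tagnat.sig1 q) (tagnat.sig2 q).
  rewrite [LHS]tagnat.rect /flatten_index; congr addn.
  have szsh : size (take (tagnat.sig1 q) (shape xss)) = tagnat.sig1 q.
    by rewrite size_takel // size_map szx ltnW.
  rewrite sumnE (big_nth 0%N) szsh big_mkord.
  rewrite (big_ord_widen n _ (ltnW (ltn_ord (tagnat.sig1 q)))).
  by apply: eq_bigr => i lti; rewrite nth_take// nthsh.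
have lt2 : (tagnat.sig2 q < nth 0%N (shape xss) (tagnat.sig1 q))%N.
  by rewrite nthsh.
by rewrite [in LHS]qE nth_flatten flatten_indexKl// flatten_indexKr.
Qed.

(** On explicit lists the right-hand side computes, which turns iterated
composites with units into a calculation. *)
Lemma lcompA s ys (zss : seq (seq anyop)) :
  size ys = tag s -> shape zss = [seq tag y | y <- ys] ->
  lcomp (lcomp s ys) (flatten zss) =
  lcomp s [seq lcomp p.1 p.2 | p <- zip ys zss].
Proof.
move=> szy shz.
have szz : size zss = size ys by rewrite -(size_map size) -/(shape _) shz size_map.
pose y (i : 'I_(tag s)) := nth (pack op_one) ys i.
have szi (i : 'I_(tag s)) : size (nth [::] zss i) = tag (y i).
  rewrite -(nth_map _ 0%N size) ?szz ?szy//.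
  by rewrite -/(shape _) shz (nth_map (pack op_one)) ?szy.
transitivity (fcomp (tagged (fcomp (tagged s) y)) (fun q =>
   nth (pack op_one) (nth [::] zss (tagnat.sig1 q)) (tagnat.sig2 q))).
  congr fcomp; apply/funext => q.
  by rewrite (nth_flatten_rank _ _ _ szi) // szz.
rewrite -(@fcompA _ _ y (fun i j => nth (pack op_one) (nth [::] zss i) j)).
congr fcomp; apply/funext => i.
rewrite (nth_map (pack op_one, [::])) ?size_zip ?szz ?minnn ?szy//.
by rewrite nth_zip.
Qed.

(** The value 0 in the wrong arity makes [unpack] total, hence linear in the
operations that it is applied to. *)
Definition unpack n (s : anyop) : P n := untag 0 (fun x : P n => x) s.

Lemma packK n (x : P n) : unpack n (pack x) = x.
Proof.
rewrite /unpack /untag; case: eqP => // e.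
by rewrite /etagged eq_axiomK.
Qed.

Lemma unpackK n (s : anyop) : tag s = n -> pack (unpack n s) = s.
Proof. by case: s => m x /= <-; rewrite packK. Qed.

Lemma pack_inj n (x y : P n) : pack x = pack y -> x = y.
Proof. by move=> e; rewrite -(packK x) e packK. Qed.

Lemma unpack_linear n m (f : P n -> P m) p : linear f -> linear (fun x => unpack p (pack (f x))).
Proof.
move=> lf a u v; have [e|ne] := eqVneq m p.
  by case: _ / e; rewrite !packK lf.
by rewrite /unpack !untag_dflt// scaler0 addr0.
Qed.

Definition is_zero (s : anyop) := tagged s == 0.

Lemma op_comp_0r n (k : 'I_n -> nat) (x : P n) (y : forall i, P (k i)) (i : 'I_n) :
  y i = 0 -> op_comp x y = 0.
Proof.
move=> yi0.
have ->: y = dfwith y (0 : P (k i)).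
  by apply: functional_extensionality_dep => j; case: dfwithP.
have /= := op_comp_linr x y 1 (0 : P (k i)) 0; rewrite !scale1r addr0.
by rewrite -[X in X = _ -> _]addr0 => /addrI.
Qed.

Lemma is_zero_fcomp n (x : P n) y (i : 'I_n) : is_zero (y i) -> is_zero (fcomp x y).
Proof. by move=> /eqP yi; rewrite /is_zero /= (op_comp_0r _ yi). Qed.

Lemma is_zero_unpack n (s : anyop) : is_zero s -> unpack n s = 0.
Proof.
move=> /eqP; case: s => m x /= ->.
have [e|ne] := eqVneq m n; last by rewrite /unpack untag_dflt.
by case: _ / e; rewrite packK.
Qed.

Lemma fcomp_linear n (y : 'I_n -> anyop) m :
  linear (fun x : P n => unpack m (fcomp x y)).
Proof. exact/unpack_linear/op_comp_linl. Qed.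

End TotalSpace.

(** * Elements killed by deletions make an operad grow *)

Section Growth.
Variables (K : fieldType) (P : operad2u K).

Definition S0 : anyop P := pack (tu_0 P).
Definition S1 : anyop P := pack op_one.
Definition S2 : anyop P := pack (tu_2 P).

Lemma pack_comp2 p q (x : P 2%N) (a : P p) (b : P q) :
  pack (comp2 x a b) = lcomp (pack x) [:: pack a; pack b].
Proof.
transitivity (fcomp x (fun i => pack
    (if i == ord0 as c return P (if c then p else q) then a else b))).
  by [].
congr fcomp; apply/funext => i.
by case: (ord0 =P i) => [<-|]; case: i => [[|[|]]].
Qed.

Lemma S2_S0l : lcomp S2 [:: S0; S1] = S1.
Proof. by rewrite -pack_comp2; exact: tu_2l. Qed.

Lemma S2_S0r : lcomp S2 [:: S1; S0] = S1.
Proof. by rewrite -pack_comp2; exact: tu_2r. Qed.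

Lemma lcompS0 : lcomp S0 [::] = S0.
Proof. exact: (lcompx1 S0). Qed.

Lemma lcomp_S2l s : lcomp S2 [:: S0; s] = s.
Proof.
have := @lcompA _ _ S2 [:: S0; S1] [:: [::]; [:: s]] erefl erefl.
by rewrite S2_S0l /= lcompS0 !lcomp1x => <-.
Qed.

Lemma lcomp_S2r s : lcomp S2 [:: s; S0] = s.
Proof.
have := @lcompA _ _ S2 [:: S1; S0] [:: [:: s]; [::]] erefl erefl.
by rewrite S2_S0r /= lcompS0 !lcomp1x => <-.
Qed.

(** The arity [m] is meant to be the sum of the arities of [ys]. *)
Definition plug n (ys : seq (anyop P)) m (x : P n) : P m := unpack m (lcomp (pack x) ys).

Lemma plug_linear n ys m : linear (@plug n ys m).
Proof. exact: (fcomp_linear (fun i => nth S1 ys i)). Qed.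

HB.instance Definition _ n ys m :=
  GRing.isLinear.Build K (P n) (P m) _ (@plug n ys m) (@plug_linear n ys m).

Definition ones n := nseq n S1.

Definition del_last m : 'Hom(P m.+1, P m) := linfun (plug (rcons (ones m) S0) m).
Definition del_first m : 'Hom(P m.+1, P m) := linfun (plug (S0 :: ones m) m).

Lemma sum_tag_ones n : sumn [seq tag y | y <- ones n] = n.
Proof. by rewrite map_nseq sumn_nseq mul1n. Qed.

Lemma pack_plug n ys m (x : P n) :
  size ys = n -> sumn [seq tag y | y <- ys] = m ->
  pack (plug ys m x) = lcomp (pack x) ys.
Proof. by move=> sz sm; rewrite unpackK ?tag_lcomp. Qed.

Lemma pack_del_last m (x : P m.+1) :
  pack (del_last m x) = lcomp (pack x) (rcons (ones m) S0).
Proof.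
rewrite lfunE /= pack_plug ?size_rcons ?size_nseq//.
by rewrite map_rcons -cats1 sumn_cat sum_tag_ones /= !addn0.
Qed.

Lemma pack_del_first m (x : P m.+1) :
  pack (del_first m x) = lcomp (pack x) (S0 :: ones m).
Proof. by rewrite lfunE /= pack_plug /= ?size_nseq// sum_tag_ones. Qed.

Definition ins_last m (x : P m) : P m.+1 := unpack _ (lcomp S2 [:: pack x; S1]).
Definition ins_first m (x : P m) : P m.+1 := unpack _ (lcomp S2 [:: S1; pack x]).

Lemma pack_ins_last m (x : P m) : pack (ins_last x) = lcomp S2 [:: pack x; S1].
Proof. by rewrite unpackK ?tag_lcomp//= addn1. Qed.

Lemma pack_ins_first m (x : P m) : pack (ins_first x) = lcomp S2 [:: S1; pack x].
Proof. by rewrite unpackK ?tag_lcomp//= addn0 add1n. Qed.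

Lemma size_ones n : size (ones n) = n. Proof. exact: size_nseq. Qed.

Lemma lcomp_ones n (x : P n) : lcomp (pack x) (ones n) = pack x.
Proof. exact: (lcompx1 (pack x)). Qed.

Lemma del_ins_last m (x : P m) : del_last m (ins_last x) = x.
Proof.
apply: pack_inj; rewrite pack_del_last pack_ins_last -cats1.
have := @lcompA _ _ S2 [:: pack x; S1] [:: ones m; [:: S0]] erefl.
by rewrite /= size_ones => ->//; rewrite lcomp_ones lcomp1x lcomp_S2r.
Qed.

Lemma del_ins_first m (x : P m) : del_first m (ins_first x) = x.
Proof.
apply: pack_inj; rewrite pack_del_first pack_ins_first.
have := @lcompA _ _ S2 [:: S1; pack x] [:: [:: S0]; ones m] erefl.
by rewrite /= cats0 size_ones => ->//; rewrite lcomp_ones lcomp1x lcomp_S2l.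
Qed.

Lemma del_last_ins_first m (x : P m.+1) :
  del_last m.+1 (ins_first x) = ins_first (del_last m x).
Proof.
apply: pack_inj; rewrite pack_del_last !pack_ins_first pack_del_last.
have := @lcompA _ _ S2 [:: S1; pack x] [:: [:: S1]; rcons (ones m) S0] erefl.
by rewrite /= cats0 size_rcons size_ones => ->//; rewrite lcomp1x.
Qed.

Lemma ins_first0 m : ins_first (0 : P m) = 0.
Proof.
apply: is_zero_unpack; apply: (@is_zero_fcomp _ _ _ _ _ (@Ordinal 2 1 isT)) => /=.
by rewrite /is_zero.
Qed.

Definition double_first m (x : P m.+1) : P m.+2 := plug (S2 :: ones m) m.+2 x.

Lemma pack_double_first m (x : P m.+1) :
  pack (double_first x) = lcomp (pack x) (S2 :: ones m).
Proof. by rewrite pack_plug //= ?size_nseq ?sum_tag_ones. Qed.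

Lemma map_lcomp_ones n (ys : seq (anyop P)) : size ys = n ->
  [seq lcomp p.1 p.2 | p <- zip (ones n) [seq [:: y] | y <- ys]] = ys.
Proof. by move=> <-; elim: ys => //= y ys ->; rewrite lcomp1x. Qed.

(** Associativity for a composite whose only nontrivial argument is the first one. *)
Lemma lcomp_first_block n (x : P n.+1) y ys zs : tag y = size ys -> size zs = n ->
  lcomp (lcomp (pack x) (y :: ones n)) (ys ++ zs) = lcomp (pack x) (lcomp y ys :: zs).
Proof.
move=> ty sz.
have := @lcompA _ _ (pack x) (y :: ones n) (ys :: [seq [:: z] | z <- zs]).
rewrite /= flatten_seq1 size_ones map_lcomp_ones// => ->//.
by congr (_ :: _) => //; rewrite -sz; elim: zs {sz} => //= z zs ->.
Qed.

Lemma del_first_double m (x : P m.+1) : del_first m.+1 (double_first x) = x.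
Proof.
apply: pack_inj; rewrite pack_del_first pack_double_first.
rewrite (@lcomp_first_block _ x S2 [:: S0; S1] (ones m)) ?size_ones//.
by rewrite S2_S0l; exact: (lcomp_ones x).
Qed.

(** Deleting the second input is what tells the two ways of inserting a new first
input apart: see [ker_both_neq0]. *)
Definition del_second m : 'Hom(P m.+2, P m.+1) :=
  linfun (plug (S1 :: S0 :: ones m) m.+1).

Lemma pack_del_second m (x : P m.+2) :
  pack (del_second m x) = lcomp (pack x) (S1 :: S0 :: ones m).
Proof. by rewrite lfunE /= pack_plug /= ?size_nseq// sum_tag_ones. Qed.

Lemma del_second_double m (x : P m.+1) : del_second m (double_first x) = x.
Proof.
apply: pack_inj; rewrite pack_del_second pack_double_first.
rewrite (@lcomp_first_block _ x S2 [:: S1; S0] (ones m)) ?size_ones//.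
by rewrite S2_S0r; exact: (lcomp_ones x).
Qed.

Lemma del_second_ins_first m (x : P m.+1) :
  del_second m (ins_first x) = ins_first (del_first m x).
Proof.
apply: pack_inj; rewrite pack_del_second !pack_ins_first pack_del_first.
have := @lcompA _ _ S2 [:: S1; pack x] [:: [:: S1]; S0 :: ones m] erefl.
by rewrite /= cats0 size_ones => ->//; rewrite lcomp1x.
Qed.

Lemma del_last_double m (x : P m.+2) :
  del_last m.+2 (double_first x) = double_first (del_last m.+1 x).
Proof.
apply: pack_inj; rewrite pack_del_last !pack_double_first pack_del_last.
rewrite (@lcomp_first_block _ x S2 [:: S1; S1] (rcons (ones m) S0)) ?size_rcons ?size_ones//.
have -> : lcomp S2 [:: S1; S1] = S2 by exact: (lcomp_ones (tu_2 P)).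
have := @lcompA _ _ (pack x) (rcons (ones m.+1) S0)
  ([:: S2] :: rcons [seq [:: z] | z <- ones m] [::]).
rewrite /= -!cats1 flatten_cat flatten_seq1 /= cats0 !cats1.
move=> ->; rewrite ?size_rcons ?size_nseq//; last first.
  by rewrite /shape !map_rcons !map_nseq.
rewrite zip_rcons ?map_rcons ?size_nseq ?size_map ?size_nseq//.
by rewrite map_lcomp_ones ?size_ones// lcomp1x lcompS0.
Qed.

Definition ker_last m : {vspace P m.+1} := lker (del_last m).
Definition ker_both m : {vspace P m.+1} := (ker_last m :&: lker (del_first m))%VS.

(** If deleting the first or the last input kills x, then both deletions also kill
y = x o (1_2, 1, ..., 1) - 1_2 o (1, x): deleting the first input gives x - x,
and deleting the last one commutes with both insertions.  But deleting the second
input of y gives x back, because it turns 1_2 o (1, x) into 1_2 o (1, x')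
with x' the first deletion of x, which is zero.  The arity of x is at least 2, so
that the last input is not one of the two that replace the first one. *)
Lemma ker_both_neq0 m : ker_both m.+1 != 0%VS -> ker_both m.+2 != 0%VS.
Proof.
rewrite -!vpick0; set x := vpick _ => x0.
have /memv_capP[] : x \in ker_both m.+1 by exact: memv_pick.
rewrite !memv_ker => /eqP xl /eqP xf.
pose y := double_first x - ins_first x.
have yin : y \in ker_both m.+2.
  apply/memv_capP; rewrite !memv_ker !linearB /= del_first_double del_ins_first.
  rewrite del_last_double del_last_ins_first xl ins_first0 subr0 subrr.
  by rewrite [double_first _]linear0 eqxx.
have : del_second _ y != 0.
  by rewrite linearB /= del_second_double del_second_ins_first xf ins_first0 subr0.
apply: contraNneq => /eqP; rewrite vpick0 => /eqP k0.
by move: yin; rewrite k0 memv0 => /eqP ->; rewrite linear0.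
Qed.

(** The deletion of the last input is onto, with section [ins_last]. *)
Lemma dim_step m : \dim {:P m.+1} = (\dim (ker_last m) + \dim {:P m})%N.
Proof.
rewrite -(limg_ker_dim (del_last m) fullv) capfv; congr (_ + _)%N.
have /eqP -> // : (limg (del_last m) == fullv).
rewrite eqEsubv subvf; apply/subvP => x _.
by rewrite -(del_ins_last x) memv_img// memvf.
Qed.

(** On the kernel of the last deletion, the first deletion is onto the
kernel one arity below, with section [ins_first]. *)
Lemma dim_ker_step m :
  (\dim (ker_both m.+1) + \dim (ker_last m) <= \dim (ker_last m.+1))%N.
Proof.
rewrite -(limg_ker_dim (del_first m.+1) (ker_last m.+1)) leq_add2l.
apply/dimvS/subvP => x; rewrite memv_ker => /eqP x0.
rewrite -(del_ins_first x) memv_img// memv_ker.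
by rewrite del_last_ins_first x0 ins_first0.
Qed.

Lemma dim_ker_last k t : ker_both k.+1 != 0%VS ->
  ker_both (k.+1 + t) != 0%VS /\ (t < \dim (ker_last (k.+1 + t)))%N.
Proof.
move=> k0; elim: t => [|t [IH1 IH2]].
  rewrite addn0; split=> //; rewrite lt0n dimv_eq0; apply: contraNneq k0.
  by rewrite /ker_both => ->; rewrite cap0v.
have nz : ker_both (k.+1 + t).+1 != 0%VS by rewrite addSn ker_both_neq0.
rewrite addnS; split => //; apply: leq_trans (dim_ker_step _).
by rewrite -add1n leq_add// lt0n dimv_eq0.
Qed.

Lemma dim_quadratic k t : ker_both k.+1 != 0%VS ->
  ('C(t.+1, 2) <= \dim {:P (k.+1 + t)%N})%N.
Proof.
move=> k0; elim: t => [|t IH]; first by rewrite bin_small.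
rewrite addnS dim_step binS bin1 addnC leq_add//.
by have [] := dim_ker_last t k0.
Qed.

Lemma sum_dim_cubic k t : ker_both k.+1 != 0%VS ->
  ('C(t.+2, 3) <= \sum_(i < (k.+1 + t).+1) \dim {:P i})%N.
Proof.
move=> k0; elim: t => [|t IH]; first by rewrite bin_small.
rewrite addnS big_ord_recr binS /= leq_add//.
by have := dim_quadratic t.+1 k0; rewrite addnS.
Qed.

(** With t >= k + 1 the two bounds give (t^3 / 6)^2 <= (2 t)^5, that is
t <= 36 * 32 = 1152; the proof takes a larger t. *)
Lemma cubic_not_bounded k (S : nat -> nat) N :
  (forall t, 'C(t.+2, 3) <= S (k.+1 + t))%N ->
  ~ (forall n, (N <= n -> S n ^ 2 <= n ^ 5)%N).
Proof.
move=> Slb Sub; pose t := (N + k.+1 + 1153)%N.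
have t0 : (0 < t)%N by rewrite /t addnS.
have h1 : ('C(t.+2, 3) ^ 2 <= (2 * t) ^ 5)%N.
  apply: (@leq_trans (S (k.+1 + t)%N ^ 2)); first by rewrite leq_exp2r.
  apply: (@leq_trans ((k.+1 + t) ^ 5)).
    by apply: Sub; rewrite /t; lia.
  by rewrite leq_exp2r// /t; lia.
have h2 : (t ^ 3 <= 6 * 'C(t.+2, 3))%N.
  rewrite mulnC -[6%N]/(3`!) bin_ffact !ffactnS ffactn0 muln1 /=.
  by rewrite !expnS expn0 muln1 !leq_mul// ltnW// ltnW.
have h3 : (t ^ 6 <= 36 * 32 * t ^ 5)%N.
  rewrite (_ : 6 = 3 * 2)%N// expnM.
  apply: (@leq_trans ((6 * 'C(t.+2, 3)) ^ 2)); first by rewrite leq_exp2r.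
  by rewrite expnMn -mulnA leq_mul// (leq_trans h1)// expnMn.
move: h3; rewrite expnSr [leqLHS]mulnC leq_pmul2r ?expn_gt0 ?t0//.
by rewrite /t; lia.
Qed.

Definition is_restr (w : anyop P) := w = S0 \/ w = S1.

Lemma fcomp_restr s (z : 'I_(tag s) -> anyop P) :
  is_restr s -> (forall j, is_restr (z j)) -> is_restr (fcomp (tagged s) z).
Proof.
move=> [] E; subst s => /= zr.
  left; rewrite /S0 -[RHS]fcompx1; congr fcomp.
  by apply/funext => -[].
suff -> : fcomp op_one z = z ord0 by [].
by rewrite -[RHS]fcomp1x; congr fcomp; apply/funext => i; rewrite ord1.
Qed.

(** The arguments are indexed by [nat], and not by the inputs of [s], so that the
predicate can be transported along equations between elements of the total
space. *)
Definition small_restr_zero (s : anyop P) := forall w : nat -> anyop P,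
  (forall i, is_restr (w i)) ->
  (tag (fcomp (tagged s) (fun i => w i)) <= 1)%N ->
  is_zero (fcomp (tagged s) (fun i => w i)).

(** A restriction of a restriction of [x] is again a restriction of [x]. *)
Lemma small_restr_zero_fcomp n (x : P n) (y : 'I_n -> anyop P) :
  (forall i, is_restr (y i)) -> small_restr_zero (pack x) ->
  small_restr_zero (fcomp x y).
Proof.
move=> yr xz w wr.
pose v (i : 'I_n) : anyop P :=
  fcomp (tagged (y i)) (fun j => w (@tagnat.Rank _ (fun i => tag (y i)) i j)).
pose w' i := oapp v S0 (insub i).
have w'r i : is_restr (w' i).
  rewrite /w'; case: insub => [j|] /=; last by left.
  exact: fcomp_restr.
have -> : fcomp (tagged (fcomp x y)) (fun i => w i) =
    fcomp x (fun i => w' i).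
  transitivity (fcomp x v).
    rewrite /v fcompA; congr fcomp; apply/funext => q.
    by rewrite tagnat.sig2K.
  by congr fcomp; apply/funext => i; rewrite /w' valK.
exact: (xz w').
Qed.

Hypothesis nogrowth : forall k, ker_both k.+1 = 0%VS.

(** Induction on the arity n.  If n <= 1, [x] is itself one of its small
restrictions.  Otherwise its two deletions vanish by induction, so that [x]
lies in [ker_both]. *)
Lemma small_restr_inj n (x : P n) : small_restr_zero (pack x) -> x = 0.
Proof.
elim/ltn_ind: n x => n IH x xz.
have w1 : (n <= 1)%N -> x = 0.
  move=> n1; have := xz (fun=> S1) (fun=> or_intror erefl).
  rewrite (_ : fcomp _ _ = pack x); last exact: fcompx1.
  by move=> /(_ n1) /eqP.
case: n IH x xz w1 => [|[|m]] IH x xz w1; [exact: w1|exact: w1|].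
have xl : del_last _ x = 0.
  apply: (IH m.+1) => //; rewrite pack_del_last.
  apply: small_restr_zero_fcomp xz => i.
  by rewrite nth_rcons /ones nth_nseq; do !case: ifP => _; [right|right|left|right].
have xf : del_first _ x = 0.
  apply: (IH m.+1) => //; rewrite pack_del_first.
  apply: small_restr_zero_fcomp xz => -[[|i] lti]; first by left.
  by rewrite -[nth _ _ _]/(nth S1 (nseq m.+1 S1) i) nth_nseq if_same; right.
have : x \in ker_both m.+1.
  by apply/memv_capP; rewrite !memv_ker xl xf eqxx.
by rewrite nogrowth memv0 => /eqP.
Qed.

End Growth.

(** * Logarithmic growth of integer sequences *)

Section LogGrowth.
Variable R : realType.

Definition log_growth (S : nat -> nat) : \bar R :=
  limn_esup (fun n => (ln (S n)%:R / ln n%:R)%:E).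

(** The limsup is below 5/2, so S n <= n^(5/2) eventually; squaring gives a bound
between natural numbers. *)
Lemma log_growth_le2 (S : nat -> nat) : (forall n, 0 < S n)%N ->
  (log_growth S <= 2%:E)%E -> exists N, forall n, (N <= n -> S n ^ 2 <= n ^ 5)%N.
Proof.
move=> S0 S2.
have : (log_growth S < (5 / 2)%:E)%E by rewrite (le_lt_trans S2)// lte_fin; lra.
move=> /ereal_inf_lt[_ [V [N _ NV] <-]] supV.
exists (maxn N 2) => n; rewrite geq_max => /andP[Nn n2].
have n1 : (1 : R) < n%:R by rewrite ltr1n.
have Sn0 : (0 : R) < (S n)%:R by rewrite ltr0n.
have n0 : (0 : R) < n%:R by rewrite ltr0n ltnW.
have : ((ln (S n)%:R / ln n%:R)%:E < (5 / 2)%:E :> \bar R)%E.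
  by apply: le_lt_trans supV; apply: ereal_sup_ubound; exists n => //; exact: NV.
rewrite lte_fin ltr_pdivrMr ?ln_gt0// => lnS.
rewrite -(ler_nat R) !natrX -ler_ln ?posrE ?exprn_gt0// !lnXn//.
rewrite -[_ *+ 2]mulr_natr -[_ *+ 5]mulr_natr.
by lra.
Qed.

(** ln (C n^2) / ln n = 2 + ln C / ln n, and the last term tends to 0. *)
Lemma quadratic_log_growth (S : nat -> nat) C : (forall n, 0 < S n)%N ->
  (forall n, 0 < n -> S n <= C * n ^ 2)%N -> (log_growth S <= 2%:E)%E.
Proof.
move=> S0 SC; apply/lee_addgt0Pr => e e0.
have C0 : (0 < C)%N by have := leq_trans (S0 1%N) (SC 1%N isT); rewrite muln1.
(* ln C <= e ln n as soon as n exceeds M; the offset 2 ensures ln n > 0. *)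
pose M : R := expR (ln C%:R / e); pose N := (Num.bound M).+2.
apply: ge_ereal_inf; exists (ereal_sup
    ((fun n => (ln (S n)%:R / ln n%:R)%:E) @` [set n | (N <= n)%N]%classic)).
  by exists [set n | (N <= n)%N]%classic => //; exists N.
apply: ge_ereal_sup => _ [n /= Nn <-]; rewrite lee_fin.
have n2 : (1 < n)%N by apply: leq_trans Nn.
have n0 : (0 : R) < n%:R by rewrite ltr0n ltnW.
have lnn : 0 < ln n%:R :> R by rewrite ln_gt0// ltr1n.
have Mn : M <= n%:R.
  rewrite (le_trans (ltW (archi_boundP (expR_ge0 _))))// ler_nat.
  by rewrite (leq_trans _ Nn)// /N -addn2 leq_addr.
have lnC : ln C%:R <= e * ln n%:R.
  by rewrite mulrC -ler_pdivrMr// -ler_expR lnK.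
rewrite ler_pdivrMr//; apply: (@le_trans _ _ (ln (C * n ^ 2)%:R)).
  by rewrite ler_ln ?posrE ?ltr0n ?muln_gt0 ?C0 ?expn_gt0 ?S0 ?(ltnW n2)// ler_nat SC// ltnW.
rewrite natrM natrX lnM ?posrE ?exprn_gt0 ?ltr0n ?(ltnW n2)// lnXn//.
by rewrite -[_ *+ 2]mulr_natr; lra.
Qed.

End LogGrowth.

Section GK2.
Variables (K : fieldType) (R : realType) (P : operad2u K).

Lemma sum_dim_gt0 n : (0 < \sum_(i < n.+1) \dim {:P i})%N.
Proof.
rewrite big_ord_recl /= -(span_basis (tu_0_basis P)) (eqP (basis_free (tu_0_basis P))).
by [].
Qed.

Lemma GK2_ker_both : (GKdim R P <= 2%:E)%E -> forall k, ker_both P k.+1 = 0%VS.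
Proof.
move=> /(log_growth_le2 sum_dim_gt0)[N SN] k; apply/eqP; apply: contraT => k0.
have lb t := sum_dim_cubic t k0.
by case: (@cubic_not_bounded k (fun n => \sum_(i < n.+1) \dim {:P i})%N N lb).
Qed.

End GK2.

(** * Lexicographic numbering of pairs *)

Section TagnatBig.
Variables (n : nat) (k : 'I_n -> nat).

Lemma big_tagnat (T : Type) (idx : T) (op : Monoid.com_law idx)
    (F : {i : 'I_n & 'I_(k i)} -> T) :
  \big[op/idx]_(q < \sum_i k i) F (tagnat.sig q) =
  \big[op/idx]_i \big[op/idx]_(j < k i) F (Tagged _ j).
Proof.
rewrite (reindex (@tagnat.rank n k)) /=; last exact: tagnat.rank_bij_on.
under eq_bigr do rewrite tagnat.rankK.
by rewrite sig_big_dep; apply: eq_bigr => -[].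
Qed.

Lemma ltn_Rank_lex i (j : 'I_(k i)) (q : 'I_(\sum_i k i)) :
  (@tagnat.Rank n k i j < q)%N =
  (i < tagnat.sig1 q)%N || ((i == tagnat.sig1 q) && (j < tagnat.sig2 q)%N).
Proof.
rewrite -[in LHS](tagnat.sigK q).
rewrite -[LHS]/(tagnat.rank (Tagged _ j) < tagnat.rank (tagnat.sig q))%O.
rewrite tagnat.lt_rank ltEsig /= !leEord.
rewrite -/(tagnat.sig1 q).
have [//|gt|/val_inj ii] := ltngtP i (tagnat.sig1 q).
  by case: eqP => // ii; rewrite ii ltnn in gt.
rewrite /tagnat.sig2 /tagnat.sig1 in ii *.
by case: (tagnat.sig q) ii => i0 j0 /= ii; subst i0; rewrite tagged_asE eqxx ltEord.
Qed.

(** The offset of the block q, in a concatenation of blocks indexed by pairs in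
lexicographic order; it shows that the two ways of numbering triples agree. *)
Lemma sum_before_lex (L : {i : 'I_n & 'I_(k i)} -> nat) (q : 'I_(\sum_i k i)) :
  (\sum_(q' < \sum_i k i | (q' < q)%N) L (tagnat.sig q') =
   \sum_(i < n | (i < tagnat.sig1 q)%N) \sum_(j < k i) L (Tagged _ j) +
   \sum_(j < k (tagnat.sig1 q) | (j < tagnat.sig2 q)%N) L (Tagged _ j))%N.
Proof.
pose F u := if (tagnat.rank u < q)%N then L u else 0%N.
have -> : (\sum_(q' < \sum_i k i | (q' < q)%N) L (tagnat.sig q') =
    \sum_(q' < \sum_i k i) F (tagnat.sig q'))%N.
  by rewrite big_mkcond; apply: eq_bigr => q' _; rewrite /F tagnat.sigK.
rewrite big_tagnat /= (bigID (fun i : 'I_n => (i < tagnat.sig1 q)%N)) /=.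
congr addn.
  by apply: eq_bigr => i lti; apply: eq_bigr => j _; rewrite /F ltn_Rank_lex lti.
rewrite (bigD1 (tagnat.sig1 q)) ?ltnn//= [X in (_ + X)%N]big1 ?addn0.
  rewrite [RHS]big_mkcond; apply: eq_bigr => j _.
  by rewrite /F ltn_Rank_lex ltnn eqxx.
move=> i /andP[/negbTE nlt /negbTE ne]; rewrite big1// => j _.
by rewrite /F ltn_Rank_lex nlt ne.
Qed.

End TagnatBig.

(** * The operad of an algebra *)

Section AlgebraOperad.
Variables (K : fieldType) (A : fdalg K).

(** The A-component of (c + a)(d + b) in the unital algebra K + A. *)
Definition umul (c : K) (a : A) (d : K) (b : A) : A := c *: b + d *: a + fa_mul a b.

Lemma fa_mulDl (a b c : A) : fa_mul (a + b) c = fa_mul a c + fa_mul b c.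
Proof. by have := fa_linl c 1 a b; rewrite !scale1r. Qed.

Lemma fa_mulDr (a b c : A) : fa_mul c (a + b) = fa_mul c a + fa_mul c b.
Proof. by have := fa_linr c 1 a b; rewrite !scale1r. Qed.

Lemma fa_mul0l (c : A) : fa_mul 0 c = 0.
Proof. by apply: (addrI (fa_mul 0 c)); rewrite -fa_mulDl !addr0. Qed.

Lemma fa_mul0r (c : A) : fa_mul c 0 = 0.
Proof. by apply: (addrI (fa_mul c 0)); rewrite -fa_mulDr !addr0. Qed.

Lemma fa_mulZl r (a b : A) : fa_mul (r *: a) b = r *: fa_mul a b.
Proof. by have := fa_linl b r a 0; rewrite /= fa_mul0l !addr0. Qed.

Lemma fa_mulZr r (a b : A) : fa_mul a (r *: b) = r *: fa_mul a b.
Proof. by have := fa_linr a r b 0; rewrite /= fa_mul0r !addr0. Qed.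

Lemma umul1l d b : umul 1 0 d b = b.
Proof. by rewrite /umul fa_mul0l scale1r scaler0 !addr0. Qed.

Lemma umul1r c a : umul c a 1 0 = a.
Proof. by rewrite /umul fa_mul0r scale1r scaler0 add0r !addr0. Qed.

Lemma umul_linl r c a c' a' d b :
  umul (r * c + c') (r *: a + a') d b = r *: umul c a d b + umul c' a' d b.
Proof.
rewrite /umul fa_mulDl fa_mulZl !scalerDl !scalerDr !scalerA.
by rewrite [d * r]mulrC !addrA [LHS](ACl (1*3*5*2*4*6))%AC.
Qed.

Lemma umul_linr r c a d b d' b' :
  umul c a (r * d + d') (r *: b + b') = r *: umul c a d b + umul c a d' b'.
Proof.
rewrite /umul fa_mulDr fa_mulZr !scalerDl !scalerDr !scalerA.
by rewrite [c * r]mulrC !addrA [LHS](ACl (1*3*5*2*4*6))%AC.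
Qed.

Lemma umulZl r c a d b : umul (r * c) (r *: a) d b = r *: umul c a d b.
Proof. by rewrite /umul fa_mulZl !scalerDr !scalerA [d * r]mulrC. Qed.

Lemma umulZr r c a d b : umul c a (r * d) (r *: b) = r *: umul c a d b.
Proof. by rewrite /umul fa_mulZr !scalerDr !scalerA [c * r]mulrC. Qed.

Lemma umulA c a d b e f :
  umul c a (d * e) (umul d b e f) = umul (c * d) (umul c a d b) e f.
Proof.
rewrite /umul !fa_mulDl !fa_mulDr !fa_mulZl !fa_mulZr !scalerDr !scalerA fa_mulA.
rewrite [e * c]mulrC [e * d]mulrC.
by rewrite !addrA [LHS](ACl (1*2*4*6*3*5*7))%AC.
Qed.

Definition algop_sort n : vectType K := (K^o * {ffun 'I_n -> A})%type.

(** Elements of equal arity can be compared entry by entry along the values of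
the indices, without casts. *)
Lemma heq_algop m n (x : algop_sort m) (y : algop_sort n) :
  m = n -> x.1 = y.1 ->
  (forall j : 'I_n, exists2 i : 'I_m, val i = val j & x.2 i = y.2 j) ->
  heq algop_sort x y.
Proof.
move=> mn; case: _ / mn y => y e1 e2; congr existT.
rewrite [x]surjective_pairing [y]surjective_pairing e1; congr pair.
by apply/ffunP => j; have [i /val_inj -> ->] := e2 j.
Qed.

Definition algop_act n (x : algop_sort n) (s : 'S_n) : algop_sort n :=
  (x.1, [ffun i => x.2 (s i)]).

(** The n-fold product, all of whose restrictions to one input are the identity. *)
Definition algop_prod n : algop_sort n := (1, 0).

(** Plugging 1_0 everywhere outside the input j of y_i turns y_(i') into its
augmentation for i' <> i; what is left is the product, in K + A, of the i-th
entry of x and the j-th entry of y_i. *)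
Definition algop_coef n (k : 'I_n -> nat) (x : algop_sort n)
    (y : forall i, algop_sort (k i)) (u : {i : 'I_n & 'I_(k i)}) : A :=
  (\prod_(i | i != tag u) (y i).1) *:
  umul x.1 (x.2 (tag u)) (y (tag u)).1 ((y (tag u)).2 (tagged u)).

Definition algop_comp n (k : 'I_n -> nat) (x : algop_sort n)
    (y : forall i, algop_sort (k i)) : algop_sort (\sum_i k i)%N :=
  (x.1 * \prod_i (y i).1, [ffun q => algop_coef x y (tagnat.sig q)]).

Lemma algop_act_linear n (s : 'S_n) : linear (fun x => algop_act x s).
Proof. by move=> r x y; congr pair; apply/ffunP => i; rewrite !ffunE. Qed.

Lemma algop_act1 n (x : algop_sort n) : algop_act x 1%g = x.
Proof.
by case: x => c a; congr pair; apply/ffunP => i; rewrite !ffunE perm1.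
Qed.

Lemma algop_actM n (s t : 'S_n) (x : algop_sort n) :
  algop_act (algop_act x s) t = algop_act x (t * s)%g.
Proof. by congr pair; apply/ffunP => i; rewrite !ffunE permM. Qed.

Lemma algop_comp_linl n (k : 'I_n -> nat) (y : forall i, algop_sort (k i)) :
  linear (fun x : algop_sort n => algop_comp x y).
Proof.
move=> r x x'; congr pair; first by rewrite /= mulrDl -mulrA.
apply/ffunP => q; rewrite !ffunE /algop_coef /= !ffunE umul_linl scalerDr !scalerA.
by rewrite [r * _]mulrC.
Qed.

Lemma algop_comp_linr n (k : 'I_n -> nat) (x : algop_sort n)
    (y : forall i, algop_sort (k i)) (i : 'I_n) :
  linear (fun z : algop_sort (k i) => algop_comp x (dfwith y z)).
Proof.
have prodE (Q : pred 'I_n) z : Q i -> \prod_(i' | Q i') (dfwith y z i').1 =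
    (z : algop_sort (k i)).1 * \prod_(i' | Q i' && (i' != i)) (y i').1.
  move=> Qi; rewrite (bigD1 i)//= dfwith_in; congr (_ * _).
  by apply: eq_bigr => j /andP[_ ji]; rewrite dfwith_out// eq_sym.
move=> r z z'; congr pair.
  by rewrite /= !prodE//= mulrDl mulrDr -mulrA mulrCA.
apply/ffunP => q; rewrite !ffunE /algop_coef; case: (tagnat.sig q) => j l /=.
have [e|ne] := eqVneq j i.
  subst j; rewrite !dfwith_in /= !ffunE umul_linr scalerDr !scalerA.
  have pE (w : algop_sort (k i)) :
      \prod_(i' | i' != i) (dfwith y w i').1 = \prod_(i' | i' != i) (y i').1.
    by apply: eq_bigr => i2 ii2; rewrite dfwith_out// eq_sym.
  by rewrite !pE [r * _]mulrC.
rewrite !dfwith_out ?[i == j]eq_sym// !prodE ?[i == j]eq_sym//=.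
by rewrite mulrDl scalerDl scalerA mulrA.
Qed.

Lemma algop_comp1 n (x : algop_sort n) :
  heq algop_sort (algop_comp x (fun _ : 'I_n => algop_prod 1)) x.
Proof.
apply: heq_algop; first by rewrite sum1_card card_ord.
  by rewrite /= big1// mulr1.
move=> i; exists (@tagnat.Rank n (fun=> 1%N) i ord0); last first.
  by rewrite ffunE tagnat.rankK /algop_coef /= ffunE umul1r big1// scale1r.
apply: (etrans (tagnat.RankEsum _)); rewrite addn0 -(big_ord_widen n (fun=> 1%N) (ltnW (ltn_ord i))).
by rewrite sum1_card card_ord.
Qed.

Lemma algop_1comp n (x : algop_sort n) :
  heq algop_sort (algop_comp (algop_prod 1) (fun _ : 'I_1 => x)) x.
Proof.
apply: heq_algop; first by rewrite big_ord1.
  by rewrite /= big_ord1 mul1r.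
move=> i; exists (@tagnat.Rank 1 (fun=> n) ord0 i); last first.
  rewrite ffunE tagnat.rankK /algop_coef /= ffunE umul1l.
  by rewrite big_pred0 ?scale1r// => j; rewrite ord1.
by apply: (etrans (tagnat.RankEsum _)); rewrite big_pred0.
Qed.

(** Up to the scalar factors this is associativity in K + A at each triple
(i, j, e); both sides carry the augmentations of the y_(i') with i' <> i and
those of all the other z_(i', j'). *)
Lemma algop_compA n (k : 'I_n -> nat) (l : forall i, 'I_(k i) -> nat)
    (x : algop_sort n) (y : forall i, algop_sort (k i))
    (z : forall i (j : 'I_(k i)), algop_sort (l i j)) :
  heq algop_sort
    (algop_comp x (fun i => algop_comp (y i) (z i)))
    (algop_comp (algop_comp x y) (fun q => z (tagnat.sig1 q) (tagnat.sig2 q))).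
Proof.
pose Z (u : {i : 'I_n & 'I_(k i)}) := (z (tag u) (tagged u)).1.
apply: heq_algop.
- exact: esym (big_tagnat _ (fun u => l (tag u) (tagged u))).
- rewrite /= big_split /= mulrA; congr (_ * _).
  exact: esym (big_tagnat _ Z).
move=> p; pose q := tagnat.sig1 p.
pose i := tagnat.sig1 q; pose j : 'I_(k i) := tagnat.sig2 q.
pose e : 'I_(l i j) := tagnat.sig2 p.
exists (@tagnat.Rank n (fun i => \sum_j l i j)%N i (@tagnat.Rank (k i) (l i) j e)).
  apply: (etrans (tagnat.RankEsum _)); rewrite tagnat.RankEsum addnA.
  rewrite [RHS]tagnat.rect; congr addn.
  exact: esym (sum_before_lex (fun u => l (tag u) (tagged u)) q).
rewrite !ffunE tagnat.rankK /algop_coef /= -/q !ffunE tagnat.rankK /algop_coef /=.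
rewrite -/i -/j -/e.
have -> : \prod_(q' | q' != q) (z (tagnat.sig1 q') (tagnat.sig2 q')).1 =
  (\prod_(i' | i' != i) \prod_(j' < k i') (z i' j').1) *
  \prod_(j' | j' != j) (z i j').1.
  (* Padding by 1 makes the product over q' <> q a full product, which splits over pairs. *)
  pose G u := if u != tagnat.sig q then Z u else 1.
  transitivity (\prod_q' G (tagnat.sig q')).
    by rewrite big_mkcond; apply: eq_bigr => q' _; rewrite /G (inj_eq (@tagnat.sig_inj _ _)).
  rewrite big_tagnat /= (bigD1 i)//= mulrC; congr (_ * _).
    apply: eq_bigr => i' ii'; apply: eq_bigr => j' _.
    rewrite /G ifT //; apply: contraNneq ii' => /(congr1 tag) /= ->.
    exact: eqxx.
  rewrite [RHS]big_mkcond; apply: eq_bigr => j' _.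
  by rewrite /G tagnat.sigE12 eq_Tagged.
rewrite big_split /= (bigD1 j (P := predT))//=.
set pY := \prod_(i' | _) (y _).1; set pZ := \prod_(i' | _) \prod_(j' | _) _.
set pZi := \prod_(j' | _) (z _ _).1.
(* Folds the coordinates of [p], which are unfolded in the goal. *)
rewrite -[RHS]/((pZ * pZi : K) *: umul (x.1 * \prod_i' (y i').1)
  ((pY : K) *: umul x.1 (x.2 i) (y i).1 ((y i).2 j)) (z i j).1 ((z i j).2 e)).
rewrite [(z i j).1 * pZi]mulrC [(y i).1 * _]mulrCA umulZr.
rewrite (bigD1 i (P := predT))//= -/pY.
rewrite [(y i).1 * pY]mulrC mulrCA umulZl umulA !scalerA.
by congr (_ *: _); rewrite -mulrA mulrC.
Qed.

Lemma algop_equiv_in n (k : 'I_n -> nat) (t : forall i, 'S_(k i))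
    (x : algop_sort n) (y : forall i, algop_sort (k i)) :
  algop_comp x (fun i => algop_act (y i) (t i)) = algop_act (algop_comp x y) (sum_perm t).
Proof.
congr pair; apply/ffunP => q; rewrite !ffunE permE.
by rewrite tagnat.rankK /algop_coef /= ffunE.
Qed.

Lemma algop_equiv_out n (k : 'I_n -> nat) (s : 'S_n)
    (x : algop_sort n) (y : forall i, algop_sort (k i)) :
  heq algop_sort
    (algop_comp (algop_act x s) (fun i => y (s i)))
    (algop_act (algop_comp x y) (block_perm k s)).
Proof.
apply: heq_algop.
- exact: esym (block_size k s).
- by rewrite /= [in RHS](reindex_inj (@perm_inj _ s)).
move=> p; exists (cast_ord (block_size k s) p) => //.
rewrite !ffunE permE tagnat.rankK /algop_coef /= ffunE.
rewrite [in RHS](reindex_inj (@perm_inj _ s)) /=.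
by under [in RHS]eq_bigl do rewrite (inj_eq perm_inj).
Qed.

Definition algop_operad : operad K :=
  Operad algop_act_linear algop_act1 algop_actM algop_comp_linl algop_comp_linr algop_comp1
    algop_1comp algop_compA algop_equiv_in algop_equiv_out.

Lemma algop_comp_prod n (k : 'I_n -> nat) :
  algop_comp (algop_prod n) (fun i => algop_prod (k i)) = algop_prod (\sum_i k i).
Proof.
congr pair; first by rewrite big1 ?mulr1.
by apply/ffunP => q; rewrite !ffunE /algop_coef /= !ffunE umul1r scaler0.
Qed.

Lemma algop_comp2_prod p q r : (p + q)%N = r ->
  heq algop_sort (comp2 (algop_prod 2 : algop_operad 2%N) (algop_prod p) (algop_prod q)) (algop_prod r).
Proof.
move=> e; rewrite /comp2.
have -> : (fun i : 'I_2 => if i == ord0 as c return algop_operad (if c then p else q)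
    then algop_prod p else algop_prod q) = (fun i => algop_prod (if i == ord0 then p else q)).
  by apply: functional_extensionality_dep => i; case: (i == ord0).
have -> : op_comp (algop_prod 2 : algop_operad 2%N)
   (fun i : 'I_2 => algop_prod (if i == ord0 then p else q) : algop_operad _) = algop_prod _.
  exact: algop_comp_prod.
suff -> : (\sum_(i < 2) (if i == ord0 then p else q))%N = r by [].
by rewrite -e !big_ord_recl big_ord0 addn0.
Qed.

Lemma dim_algop n : \dim {:algop_sort n} = (1 + n * dim A)%N.
Proof.
rewrite dimvf.
have -> : dim (algop_sort n) = (dim K^o + dim {ffun 'I_n -> A})%N by [].
have -> : dim {ffun 'I_n -> A} = (#|'I_n| * dim A)%N by [].
by rewrite card_ord.
Qed.

Lemma algop_0_basis : basis_of {:algop_operad 0%N} [:: algop_prod 0 : algop_operad 0%N].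
Proof.
rewrite basisEfree seq1_free span_seq1 subvf /= (dim_algop 0) andbT.
by apply/eqP => /(congr1 fst) /eqP; rewrite oner_eq0.
Qed.

Definition algop : operad2u K := @Operad2u K algop_operad (algop_prod 0) (algop_prod 2)
  algop_0_basis (algop_comp2_prod erefl) (algop_comp2_prod erefl).

Lemma algop_2a : is_2a_unitary algop.
Proof.
exact: etrans (@algop_comp2_prod 2 1 3 erefl) (esym (@algop_comp2_prod 1 2 3 erefl)).
Qed.

Lemma GKdim_algop (R : realType) : (GKdim R algop <= 2%:E)%E.
Proof.
apply: (@quadratic_log_growth R _ (2 * (1 + dim A))).
  exact: sum_dim_gt0.
move=> n n0; under eq_bigr do rewrite dim_algop.
apply: (@leq_trans (\sum_(i < n.+1) (1 + n * dim A))%N).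
  by apply: leq_sum => i _; rewrite leq_add2l leq_mul2r -ltnS ltn_ord orbT.
rewrite sum_nat_const card_ord.
have : (1 + n * dim A <= n * (1 + dim A))%N by rewrite mulnDr muln1 leq_add2r.
by nia.
Qed.

End AlgebraOperad.

(** * Isomorphisms of functors, algebras and operads *)

Section Categories.

Lemma nat_isomorphic_sym (C D : category) (F G : functor C D) :
  nat_isomorphic F G -> nat_isomorphic G F.
Proof.
case=> eta [nat iso].
pose inv X := sval (cid (iso X)).
have invP X : compm (inv X) (eta X) = idm _ /\ compm (eta X) (inv X) = idm _.
  exact: (svalP (cid (iso X))).
exists inv; split=> [X Y f|X]; last by exists (eta X); have [] := invP X.
have [_ eX] := invP X; have [eY _] := invP Y.
by rewrite -[LHS]comp1m -eY -compmA [compm (eta Y) _]compmA -nat -!compmA eX compm1.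
Qed.

End Categories.

Section BijectiveMorphisms.
Variable K : fieldType.

Lemma fdalg_iso (A B : FdAlgCat K) (f : hom A B) (g : B -> A) :
  cancel (f : fdalg_hom A B) g -> cancel g (f : fdalg_hom A B) -> is_iso f.
Proof.
move=> fK gK.
have f0 : lker (f : fdalg_hom A B) == 0%VS by apply/lker0P; exact: can_inj fK.
have fVK : cancel (f^-1)%VF (f : fdalg_hom A B).
  by move=> y; rewrite -[y]gK lker0_lfunK.
have fM x y : (f^-1)%VF (fa_mul x y) = fa_mul ((f^-1)%VF x) ((f^-1)%VF y).
  by apply: (can_inj fK); rewrite fh_mul !fVK.
exists (FdAlgHom fM : hom B A).
split; apply: fdalg_hom_eq; apply/lfunP => x; rewrite comp_lfunE id_lfunE /=.
  by rewrite lker0_lfunK.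
exact: fVK.
Qed.

Lemma operad2u_iso (P Q : Op2uCat K) (f : hom P Q)
    (h := (f : operad2u_hom P Q)) :
  (forall n, injective (h n)) ->
  (forall n (y : (Q : operad2u K) n), exists x, h n x = y) -> is_iso f.
Proof.
move=> finj fsurj.
have f0 n : lker (h n) == 0%VS by apply/lker0P; exact: finj.
pose g n := ((h n)^-1)%VF.
have gK n : cancel (g n) (h n).
  by move=> y; have [x <-] := fsurj n y; rewrite /g lker0_lfunK.
have gact n (x : (Q : operad2u K) n) s : g n (op_act x s) = op_act (g n x) s.
  by apply: finj; rewrite oh_act !gK.
have gone : g 1%N op_one = op_one by apply: finj; rewrite gK oh_one.
have gcomp n (k : 'I_n -> nat) (x : (Q : operad2u K) n)
    (y : forall i, (Q : operad2u K) (k i)) :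
    g _ (op_comp x y) = op_comp (g n x) (fun i => g _ (y i)).
  apply: finj; rewrite gK oh_comp gK; congr op_comp.
  by apply: functional_extensionality_dep => i; rewrite gK.
have g0 : g 0%N (tu_0 Q) = tu_0 P by apply: finj; rewrite gK oh_0.
have g2 : g 2%N (tu_2 Q) = tu_2 P by apply: finj; rewrite gK oh_2.
exists (Operad2uHom gact gone gcomp g0 g2 : hom Q P).
split; apply: operad2u_hom_eq => n; apply/lfunP => x; rewrite comp_lfunE id_lfunE /=.
  exact: lker0_lfunK.
exact: gK.
Qed.

End BijectiveMorphisms.

(** * Functoriality of the operad of an algebra *)

Section AlgebraOperadFunctor.
Variable K : fieldType.

Section Morphism.
Variables (A B : fdalg K) (f : fdalg_hom A B).

Definition algop_map_fun n (x : algop A n) : algop B n := (x.1, [ffun i => f (x.2 i)]).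

Lemma algop_map_fun_linear n : linear (@algop_map_fun n).
Proof.
by move=> r x y; congr pair; apply/ffunP => i; rewrite !ffunE linearP.
Qed.

HB.instance Definition _ n :=
  GRing.isLinear.Build K (algop A n) (algop B n) _ (@algop_map_fun n) (@algop_map_fun_linear n).

Definition algop_map n : 'Hom(algop A n, algop B n) := linfun (@algop_map_fun n).

Lemma algop_mapE n (x : algop A n) : algop_map n x = algop_map_fun x.
Proof. exact: lfunE. Qed.

Lemma umul_morph c a d b : f (umul c a d b) = umul c (f a) d (f b).
Proof. by rewrite /umul !linearD !linearZ /= fh_mul. Qed.

Lemma algop_map_prod n : algop_map n (algop_prod A n) = algop_prod B n.
Proof.
by rewrite algop_mapE; congr pair; apply/ffunP => i; rewrite !ffunE linear0.
Qed.

Lemma algop_map_act n (x : algop A n) (s : 'S_n) :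
  algop_map n (op_act x s) = op_act (algop_map n x) s.
Proof.
by rewrite !algop_mapE; congr pair; apply/ffunP => i; rewrite !ffunE.
Qed.

Lemma algop_map_comp n (k : 'I_n -> nat) (x : algop A n) (y : forall i, algop A (k i)) :
  algop_map _ (op_comp x y) = op_comp (algop_map n x) (fun i => algop_map _ (y i)).
Proof.
rewrite !algop_mapE.
have -> : (fun i => algop_map _ (y i)) = (fun i => algop_map_fun (y i)).
  by apply: functional_extensionality_dep => i; rewrite algop_mapE.
congr pair; apply/ffunP => i.
by rewrite !ffunE /algop_coef linearZ /= umul_morph !ffunE.
Qed.

Definition algop_hom : operad2u_hom (algop A) (algop B) :=
  @Operad2uHom K (algop A) (algop B) algop_map algop_map_act (algop_map_prod 1) algop_map_comp
    (algop_map_prod 0) (algop_map_prod 2).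

End Morphism.

Lemma algop_hom1 (A : FdAlgCat K) :
  algop_hom (idm A) = idm (algop A : Op2uCat K) :> operad2u_hom (algop A) (algop A).
Proof.
apply: operad2u_hom_eq => n; apply/lfunP => x; rewrite id_lfunE algop_mapE.
case: x => c a; congr pair; apply/ffunP => i; rewrite ffunE /=.
by rewrite id_lfunE.
Qed.

Lemma algop_homM (A B C : FdAlgCat K) (g : hom B C) (f : hom A B) :
  algop_hom (compm g f) =
  compm (algop_hom g : hom (algop B : Op2uCat K) (algop C)) (algop_hom f) :> operad2u_hom _ _.
Proof.
apply: operad2u_hom_eq => n; apply/lfunP => x; rewrite comp_lfunE !algop_mapE.
by congr pair; apply/ffunP => i; rewrite !ffunE /= comp_lfunE.
Qed.

Section IntoSubcategory.
Variables (p : Op2uCat K -> Prop) (p_algop : forall A : fdalg K, p (algop A)).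

Definition algop_functor : functor (FdAlgCat K) (full_sub p) :=
  @Functor (FdAlgCat K) (full_sub p) (fun A => exist _ (algop A : Op2uCat K) (p_algop A))
    (fun A B f => algop_hom f) algop_hom1 (fun A B C g f => algop_homM g f).

End IntoSubcategory.

End AlgebraOperadFunctor.

(** * The augmentation ideal of the operad of an algebra *)

Section AugmentationOfAlgebraOperad.
Variables (K : fieldType) (A : fdalg K).

Lemma algop_ucomp n (x : algop A 1%N) (y : algop A n) :
  ucomp x y = (x.1 * y.1, [ffun j => @umul K A x.1 (x.2 ord0) y.1 (y.2 j)]).
Proof.
apply: heq_eq; apply: (etrans (heq_ucomp _ _)); apply: heq_algop.
- by rewrite big_ord1.
- by rewrite /= big_ord1.
move=> j; exists (@tagnat.Rank 1 (fun=> n) ord0 j).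
  by apply: (etrans (tagnat.RankEsum _)); rewrite big_pred0.
rewrite !ffunE tagnat.rankK /algop_coef /=.
by rewrite big_pred0 ?scale1r// => i; rewrite ord1.
Qed.

Lemma mem_aug_algop (x : algop A 1%N) : (x \in aug_ideal (algop A)) = (x.1 == 0).
Proof.
rewrite memv_ker lfunE /= /aug_fun algop_ucomp /= mulr1.
apply/eqP/eqP => [/(congr1 fst)//|->].
by congr pair; apply/ffunP => -[].
Qed.

Definition aug_algop_fun (x : aug_alg (algop A)) : A := (vsval x : algop A 1%N).2 ord0.

Lemma aug_algop_linear : linear aug_algop_fun.
Proof. by move=> r x y; rewrite /aug_algop_fun linearP /= !ffunE. Qed.

HB.instance Definition _ :=
  GRing.isLinear.Build K (aug_alg (algop A)) A _ aug_algop_fun aug_algop_linear.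

Lemma aug_algop0 (x : aug_alg (algop A)) : (vsval x : algop A 1%N).1 = 0.
Proof. by apply/eqP; rewrite -mem_aug_algop; exact: subvsP. Qed.

Lemma aug_algop_mul (x y : aug_alg (algop A)) :
  linfun aug_algop_fun (fa_mul x y) =
  fa_mul (linfun aug_algop_fun x) (linfun aug_algop_fun y).
Proof.
rewrite !lfunE /= /aug_algop_fun aug_mulE algop_ucomp /= ffunE !aug_algop0.
by rewrite /umul !scale0r !add0r.
Qed.

Definition aug_algop : fdalg_hom (aug_alg (algop A)) A := FdAlgHom aug_algop_mul.

Definition aug_algop_inv (a : A) : aug_alg (algop A) :=
  vsproj (aug_ideal (algop A)) (0, [ffun=> a]).

Lemma vsval_aug_algop_inv (a : A) : vsval (aug_algop_inv a) = (0, [ffun=> a]).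
Proof. by rewrite vsprojK// mem_aug_algop. Qed.

Lemma aug_algop_iso : is_iso (aug_algop : hom (aug_alg (algop A) : FdAlgCat K) A).
Proof.
apply: (@fdalg_iso _ _ _ _ aug_algop_inv) => [x|a].
  apply: subvs_inj; rewrite vsval_aug_algop_inv lfunE /= /aug_algop_fun.
  rewrite [RHS]surjective_pairing aug_algop0; congr pair.
  by apply/ffunP => j; rewrite ffunE (ord1 j).
by rewrite lfunE /= /aug_algop_fun vsval_aug_algop_inv ffunE.
Qed.

End AugmentationOfAlgebraOperad.

(** * Scalars and permutations in composites *)

Section Scaling.
Variables (K : fieldType) (P : operad K).

(** The scalars are extracted one argument at a time, along an enumeration of the inputs. *)
Lemma op_comp_scale n (k : 'I_n -> nat) (x : P n) (y : forall i, P (k i))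
    (c : 'I_n -> K) :
  op_comp x (fun i => c i *: y i) = (\prod_i c i) *: op_comp x y.
Proof.
pose yr (r : seq 'I_n) i := (if i \in r then c i else 1) *: y i.
suff IH (r : seq 'I_n) : uniq r ->
    op_comp x (yr r) = (\prod_(i <- r) c i) *: op_comp x y.
  have -> : \prod_i c i = \prod_(i <- enum 'I_n) c i by rewrite big_enum.
  rewrite -IH ?enum_uniq//; congr op_comp.
  by apply: functional_extensionality_dep => i; rewrite /yr mem_enum.
elim: r => [_|i r IH /= /andP[nir ur]].
  rewrite big_nil scale1r; congr op_comp.
  by apply: functional_extensionality_dep => i; rewrite /yr scale1r.
have yrE : yr (i :: r) = dfwith (yr r) (c i *: y i).
  apply: functional_extensionality_dep => j.
  rewrite /yr inE; have [e|ne] := eqVneq j i; first by subst j; rewrite dfwith_in.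
  by rewrite dfwith_out// eq_sym.
have yiE : dfwith (yr r) (y i) = yr r.
  apply: functional_extensionality_dep => j; case: dfwithP => //.
  by rewrite /yr (negbTE nir) scale1r.
have /= := op_comp_linr x (yr r) (c i) (y i) 0.
rewrite addr0 -yrE yiE => ->; rewrite IH// big_cons scalerA.
by rewrite (@op_comp_0r _ _ _ _ _ (dfwith (yr r) (0 : P (k i))) i) ?dfwith_in// addr0.
Qed.

Definition scale_any (c : K) (s : anyop P) : anyop P := pack (c *: tagged s).

Lemma scale_anyA c d s : scale_any c (scale_any d s) = scale_any (c * d) s.
Proof. by rewrite /scale_any /= scalerA. Qed.

Lemma scale_any1 s : scale_any 1 s = s.
Proof. by rewrite /scale_any scale1r pack_tagged. Qed.

Lemma fcomp_scale n (x : P n) (c : 'I_n -> K) (y : 'I_n -> anyop P) :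
  fcomp x (fun i => scale_any (c i) (y i)) = scale_any (\prod_i c i) (fcomp x y).
Proof. by congr pack; exact: op_comp_scale. Qed.

Lemma heq_unpack m n (y : P m) : m = n -> heq P (unpack n (pack y)) y.
Proof. by move=> mn; exact: (@unpackK _ P n (pack y) mn). Qed.

Lemma op_act_small n (x : P n) s : (n <= 1)%N -> op_act x s = x.
Proof.
move=> n1; suff -> : s = 1%g by exact: op_act1.
apply/permP => i; apply: val_inj.
by case: n n1 i {x} s => [|[|//]] _ i s; [case: i|rewrite !ord1].
Qed.

(** A composite of arity at most 1 is fixed by the block permutation, since
'S_0 and 'S_1 are trivial. *)
Lemma fcomp_act n (x : P n) (s : 'S_n) (y : 'I_n -> anyop P) :
  (tag (fcomp x y) <= 1)%N ->
  fcomp (op_act x s) (fun i => y (s i)) = fcomp x y.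
Proof.
move=> t1; have := op_equiv_out s x (fun i => tagged (y i)).
by rewrite (@op_act_small _ (op_comp _ _) _ t1) => e; exact: e.
Qed.

Lemma fcomp_ucomp n (x : P 1%N) (b : P n) :
  fcomp x (fun=> pack b) = pack (ucomp x b).
Proof. by apply: esym; exact: heq_ucomp. Qed.

End Scaling.

(** * The coordinates of an operation *)

Section Restrictions.
Variable K : fieldType.

Lemma oh_comp2 (P Q : operad2u K) (f : operad2u_hom P Q) m n (z : P 2%N)
    (x : P m) (y : P n) :
  f _ (comp2 z x y) = comp2 (f 2%N z) (f m x) (f n y).
Proof.
rewrite /comp2 oh_comp; congr op_comp.
by apply: functional_extensionality_dep => i; case: (i == ord0).
Qed.

Section Operad.
Variable P : operad2u K.
Local Notation A := (aug_alg P).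
Local Notation S0 := (S0 P).
Local Notation S1 := (S1 P).

Definition coef0 (x : P 0%N) : K := coord [tuple tu_0 P] ord0 x.

Lemma coef0E x : x = coef0 x *: tu_0 P.
Proof.
have /= := coord_basis (X := [tuple tu_0 P]) (tu_0_basis P) (memvf x).
by rewrite big_ord1.
Qed.

Lemma tu_0_neq0 : tu_0 P != 0.
Proof. by have := basis_free (tu_0_basis P); rewrite seq1_free. Qed.

Lemma coef0_scale c : coef0 (c *: tu_0 P) = c.
Proof.
apply/eqP; rewrite -subr_eq0; have := coef0E (c *: tu_0 P).
move/eqP; rewrite -subr_eq0 -scalerBl scaler_eq0 (negbTE tu_0_neq0) orbF.
by rewrite -opprB oppr_eq0.
Qed.

(** The scalar of x o (1_0, ..., 1_0) in the basis 1_0 of P(0). *)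
Definition eps n (x : P n) : K := coef0 (unpack 0 (fcomp x (fun=> S0))).

Definition single n (j : 'I_n) (i : 'I_n) : anyop P := if i == j then S1 else S0.

(** The restriction of [x] to its input [j]; the other inputs receive 1_0. *)
Definition rho n (x : P n) (j : 'I_n) : P 1%N := unpack 1 (fcomp x (single j)).

Lemma tag_fcomp n (x : P n) y : tag (fcomp x y) = (\sum_i tag (y i))%N.
Proof. by []. Qed.

Lemma fcomp_S0 n (x : P n) : fcomp x (fun=> S0) = scale_any (eps x) S0.
Proof.
rewrite /scale_any /= -coef0E unpackK// tag_fcomp.
by rewrite big1.
Qed.

Lemma tag_single n (x : P n) j : tag (fcomp x (single j)) = 1%N.
Proof.
rewrite tag_fcomp (bigD1 j)//= /single eqxx big1 ?addn0// => i /negbTE ->.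
by [].
Qed.

Lemma pack_rho n (x : P n) j : pack (rho x j) = fcomp x (single j).
Proof. by rewrite unpackK// tag_single. Qed.

Lemma epsP n (x : P n) c : fcomp x (fun=> S0) = scale_any c S0 -> eps x = c.
Proof. by move=> e; rewrite /eps e /scale_any packK coef0_scale. Qed.

Lemma rhoP n (x : P n) j y : fcomp x (single j) = pack y -> rho x j = y.
Proof. by move=> e; apply: pack_inj; rewrite pack_rho. Qed.

Lemma eps_linear n r (x y : P n) : eps (r *: x + y) = r * eps x + eps y.
Proof. by rewrite /eps fcomp_linear /coef0 linearP. Qed.

Lemma rho_linear n j : linear (fun x : P n => rho x j).
Proof. exact: fcomp_linear. Qed.

Lemma eps_act n (x : P n) s : eps (op_act x s) = eps x.
Proof.
apply: epsP; rewrite -fcomp_S0 -(@fcomp_act _ _ _ x s)//.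
by rewrite fcomp_S0.
Qed.

Lemma rho_act n (x : P n) s j : rho (op_act x s) j = rho x (s j).
Proof.
apply: rhoP; rewrite pack_rho -(@fcomp_act _ _ _ x s) ?tag_single//.
by congr fcomp; apply/funext => i; rewrite /single (inj_eq perm_inj).
Qed.

Lemma eps_fcomp n (x : P n) (y : 'I_n -> anyop P) :
  eps (tagged (fcomp x y)) = eps x * \prod_i eps (tagged (y i)).
Proof.
apply: epsP; rewrite -(@fcompA _ _ _ x y (fun _ _ => S0)).
under eq_fun do rewrite fcomp_S0.
by rewrite fcomp_scale fcomp_S0 scale_anyA mulrC.
Qed.

(** Associativity: an argument [s] in the slot [j] can be inserted after the other slots
have been filled with 1_0. *)
Lemma fcomp_one_slot n (x : P n) j s :
  fcomp x (fun i => if i == j then s else S0) = fcomp (rho x j) (fun=> s).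
Proof.
transitivity (fcomp (tagged (fcomp x (single j))) (fun=> s)); last by rewrite -pack_rho.
rewrite -(@fcompA _ _ _ x _ (fun _ _ => s)).
congr fcomp; apply/funext => i; rewrite /single.
case: (i == j); first by rewrite fcomp1x.
by rewrite -[LHS]fcompx1; congr fcomp; apply/funext => -[].
Qed.

(** By associativity, the y_(i') with i' <> i have all their inputs filled
with 1_0, hence are the scalars eps (y_(i')), and y_i becomes rho (y_i) j. *)
Lemma rho_fcomp n (x : P n) (y : 'I_n -> anyop P) (i : 'I_n) (j : 'I_(tag (y i))) :
  rho (tagged (fcomp x y)) (@tagnat.Rank n (fun i => tag (y i)) i j) =
  (\prod_(i' | i' != i) eps (tagged (y i'))) *: ucomp (rho x i) (rho (tagged (y i)) j).
Proof.
apply: rhoP; pose u : {i : 'I_n & 'I_(tag (y i))} := Tagged _ j.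
transitivity (fcomp x (fun i' => fcomp (tagged (y i')) (fun j' =>
    if (Tagged (fun i => 'I_(tag (y i))) j' == u) then S1 else S0))).
  rewrite (@fcompA _ _ _ x y (fun i' j' =>
    if (Tagged (fun i => 'I_(tag (y i))) j' == u) then S1 else S0)).
  congr fcomp; apply/funext => q; rewrite /single -tagnat.sigE12.
  by rewrite -(can_eq tagnat.sigK) tagnat.rankK.
transitivity (fcomp x (fun i' => scale_any (if i' == i then 1 else eps (tagged (y i')))
    (if i' == i then pack (rho (tagged (y i)) j) else S0))).
  congr fcomp; apply/funext => i'; have [->|ne] := eqVneq i' i.
    rewrite scale_any1 pack_rho; congr fcomp; apply/funext => j'.
    by rewrite eq_Tagged.
  rewrite -fcomp_S0; congr fcomp; apply/funext => j'.
  by case: eqP => // /(congr1 tag) /= e; rewrite e eqxx in ne.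
rewrite fcomp_scale fcomp_one_slot fcomp_ucomp /scale_any /=; congr pack; congr (_ *: _).
by rewrite [RHS]big_mkcond; apply: eq_bigr => i' _; case: eqP.
Qed.

Lemma ucomp1x n (b : P n) : ucomp op_one b = b.
Proof. by apply: pack_inj; rewrite -fcomp_ucomp fcomp1x. Qed.

Lemma ucompx1 (x : P 1%N) : ucomp x op_one = x.
Proof. by apply: pack_inj; rewrite -fcomp_ucomp fcompx1. Qed.

(** Filling the last free input of [rho x j] with 1_0 fills all the inputs of [x]. *)
Lemma ucomp_rho0 n (x : P n) j : ucomp (rho x j) (tu_0 P) = eps x *: tu_0 P.
Proof.
apply: pack_inj; rewrite -fcomp_ucomp -fcomp_one_slot.
under eq_fun do rewrite if_same.
exact: fcomp_S0.
Qed.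

Definition aug_part n (x : P n) (j : 'I_n) : A :=
  vsproj (aug_ideal P) (rho x j - eps x *: op_one).

Lemma mem_aug_ideal (x : P 1%N) : (x \in aug_ideal P) = (ucomp x (tu_0 P) == 0).
Proof. by rewrite memv_ker lfunE. Qed.

Lemma ucompBl n (x y : P 1%N) (b : P n) : ucomp (x - y) b = ucomp x b - ucomp y b.
Proof.
by have := ucomp_linl b (-1) y x; rewrite /= !scaleN1r ![- _ + _]addrC.
Qed.

Lemma ucompDl n (x y : P 1%N) (b : P n) : ucomp (x + y) b = ucomp x b + ucomp y b.
Proof. by have := ucomp_linl b 1 x y; rewrite /= !scale1r. Qed.

Lemma ucompDr n (x : P 1%N) (b c : P n) : ucomp x (b + c) = ucomp x b + ucomp x c.
Proof. by have := ucomp_linr x 1 b c; rewrite /= !scale1r. Qed.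

Lemma ucompZl n r (x : P 1%N) (b : P n) : ucomp (r *: x) b = r *: ucomp x b.
Proof.
have := ucomp_linl b r x 0; rewrite /= !addr0 => ->.
by have := ucompDl 0 0 b; rewrite addr0 -[X in X = _ -> _]addr0 => /addrI <-; rewrite addr0.
Qed.

Lemma ucompZr n r (x : P 1%N) (b : P n) : ucomp x (r *: b) = r *: ucomp x b.
Proof. by have := ucomp_linr x r b 0; rewrite /= !addr0 ucomp0 addr0. Qed.

Lemma val_aug_part n (x : P n) j : vsval (aug_part x j) = rho x j - eps x *: op_one.
Proof.
rewrite vsprojK// mem_aug_ideal ucompBl ucomp_rho0 ucompZl ucomp1x.
by rewrite subrr.
Qed.

Lemma rhoE n (x : P n) j : rho x j = vsval (aug_part x j) + eps x *: op_one.
Proof. by rewrite val_aug_part subrK. Qed.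

Lemma aug_part_linear n j : linear (fun x : P n => aug_part x j).
Proof.
move=> r x y; apply: subvs_inj; rewrite linearP !val_aug_part rho_linear eps_linear /=.
rewrite !val_aug_part scalerDl scalerBr scalerA opprD !addrA.
by congr (_ - _); rewrite addrAC.
Qed.

Definition coords_fun n (x : P n) : algop A n := (eps x, [ffun j => aug_part x j]).

Lemma coords_linear n : linear (@coords_fun n).
Proof.
move=> r x y; congr pair; first exact: eps_linear.
by apply/ffunP => j; rewrite !ffunE aug_part_linear.
Qed.

HB.instance Definition _ n :=
  GRing.isLinear.Build K (P n) (algop A n) _ (@coords_fun n) (@coords_linear n).

Definition coords n : 'Hom(P n, algop A n) := linfun (@coords_fun n).

Lemma coordsE n (x : P n) : coords n x = coords_fun x. Proof. exact: lfunE. Qed.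

Lemma coords_act n (x : P n) (s : 'S_n) : coords n (op_act x s) = op_act (coords n x) s.
Proof.
rewrite !coordsE; congr pair; first exact: eps_act.
apply/ffunP => j; rewrite !ffunE; apply: subvs_inj.
by rewrite !val_aug_part rho_act eps_act.
Qed.

Lemma coords_prod n (x : P n) :
  eps x = 1 -> (forall j, rho x j = op_one) -> coords n x = algop_prod A n.
Proof.
move=> e r; rewrite coordsE; congr pair => //.
apply/ffunP => j; rewrite !ffunE; apply: subvs_inj.
by rewrite val_aug_part e r scale1r subrr linear0.
Qed.

(** With rho x i = a + c 1 and rho y_i j = b + d 1, the composite of the two is
(ab + cb + da) + cd 1, which is the product of K + A in [umul]. *)
Lemma coords_comp n (k : 'I_n -> nat) (x : P n) (y : forall i, P (k i)) :
  coords _ (op_comp x y) = op_comp (coords n x) (fun i => coords _ (y i)).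
Proof.
rewrite !coordsE.
have -> : (fun i => coords _ (y i)) = (fun i => coords_fun (y i)).
  by apply: functional_extensionality_dep => i; rewrite coordsE.
congr pair; first exact: (eps_fcomp x (fun i => pack (y i))).
apply/ffunP => q; rewrite !ffunE -[q]tagnat.sigK; set u := tagnat.sig q.
rewrite tagnat.rankK; case: u => i j; apply: subvs_inj; rewrite val_aug_part.
rewrite (@rho_fcomp _ x (fun i => pack (y i)) i j).
rewrite (@eps_fcomp _ x (fun i => pack (y i))) /=.
rewrite /algop_coef /= !ffunE [\prod_(_ < n) _](bigD1 i)//=.
set p := \prod_(_ | _) _; rewrite mulrA [_ * p]mulrC -scalerA -scalerBr.
congr (_ *: _); rewrite aug_mulE !rhoE.
rewrite ucompDl !ucompDr !ucompZl !ucompZr ucomp1x ucompx1 ucomp1x scalerA.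
by rewrite !addrA addrK [LHS](ACl (3*2*1))%AC.
Qed.

Lemma eps_tu_0 : eps (tu_0 P) = 1.
Proof.
apply: epsP; rewrite scale_any1; rewrite -[RHS]fcompx1; congr fcomp.
by apply/funext => -[].
Qed.

Lemma rho_id (x : P 1%N) j : rho x j = x.
Proof.
apply: rhoP; rewrite -[RHS]fcompx1; congr fcomp; apply/funext => i.
by rewrite /single !ord1 eqxx.
Qed.

Lemma eps_aug (x : P 1%N) c : ucomp x (tu_0 P) = c *: tu_0 P -> eps x = c.
Proof. by move=> e; apply: epsP; rewrite fcomp_ucomp e. Qed.

Lemma coords_0 : coords 0 (tu_0 P) = tu_0 (algop A).
Proof. by apply: coords_prod => [|[]//]; exact: eps_tu_0. Qed.

Lemma coords_one : coords 1 op_one = op_one.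
Proof.
apply: coords_prod => [|j]; last exact: rho_id.
by apply: eps_aug; rewrite ucomp1x scale1r.
Qed.

Lemma coords_2 : coords 2 (tu_2 P) = tu_2 (algop A).
Proof.
apply: coords_prod.
  apply: epsP; rewrite scale_any1 -[RHS]lcomp_S2l; congr fcomp.
  by apply/funext => -[[|[|]]].
move=> j; apply: rhoP; case: j => [[|[|//]] ltj].
  by rewrite -/S1 -[RHS]lcomp_S2r; congr fcomp; apply/funext => -[[|[|]]].
by rewrite -/S1 -[RHS]lcomp_S2l; congr fcomp; apply/funext => -[[|[|]]].
Qed.

Definition coords_hom : operad2u_hom P (algop A) :=
  Operad2uHom coords_act coords_one coords_comp coords_0 coords_2.

(** The iterated product 1_2 o (... 1_2 o (1_2 o (1_0, 1), 1) ..., 1). *)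
Lemma coords_prod_ex n : exists u : P n, coords n u = algop_prod A n.
Proof.
elim: n => [|n [u pu]]; first by exists (tu_0 P); exact: coords_0.
exists (unpack n.+1 (pack (comp2 (tu_2 P) u (op_one : P 1%N)))).
apply: (@heq_eq _ (algop A)).
apply: etrans (@algop_comp2_prod _ A n 1 n.+1 (addn1 n)).
apply: (etrans (oh_heq coords_hom (y := comp2 (tu_2 P) u (op_one : P 1%N)) _)).
  by apply: heq_unpack; rewrite !big_ord_recl big_ord0 /= addn0 addn1.
have := oh_comp2 coords_hom (tu_2 P) u (op_one : P 1%N).
by rewrite /= pu coords_2 coords_one => <-.
Qed.

(** The operation u o (1 + a_1, ..., 1 + a_n), with u as in [coords_prod_ex], has
coordinates (1; a_1, ..., a_n); a multiple of u then corrects the scalar. *)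
Lemma coords_surj n (y : algop A n) : exists x, coords n x = y.
Proof.
have [u pu] := coords_prod_ex n.
pose z (j : 'I_n) : P 1%N := op_one + vsval (y.2 j).
have pz j : coords 1 (z j) = (1, [ffun=> y.2 j]).
  have e0 : eps (vsval (y.2 j)) = 0.
    by apply: eps_aug; rewrite scale0r; apply/eqP; rewrite -mem_aug_ideal subvsP.
  rewrite linearD /= coords_one coordsE; congr pair; first by rewrite /= e0 addr0.
  apply/ffunP => i; rewrite /= !ffunE add0r; apply: subvs_inj.
  by rewrite val_aug_part rho_id e0 scale0r subr0.
pose x1 : P n := unpack n (pack (op_comp u z)).
have px1 : coords n x1 = (1, y.2).
  apply: (@heq_eq _ (algop A)).
  apply: (etrans (oh_heq coords_hom (y := op_comp u z) _)).
    by apply: heq_unpack; rewrite sum1_card card_ord.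
  rewrite oh_comp /= pu.
  have -> : (fun i => coords 1 (z i)) = (fun i => (1, [ffun=> y.2 i])).
    by apply: functional_extensionality_dep => i.
  change (heq (algop_sort A) (algop_comp (algop_prod A n)
    (fun i => (1, [ffun=> y.2 i]) : algop_sort A 1)) (1, y.2)).
  apply: heq_algop.
  - by rewrite sum1_card card_ord.
  - by rewrite /= big1 ?mulr1.
  move=> i; exists (@tagnat.Rank n (fun=> 1%N) i ord0); last first.
    by rewrite ffunE tagnat.rankK /algop_coef /= !ffunE umul1l big1// scale1r.
  apply: (etrans (tagnat.RankEsum _)); rewrite addn0.
  rewrite -(big_ord_widen n (fun=> 1%N) (ltnW (ltn_ord i))).
  by rewrite sum1_card card_ord.
exists (x1 + (y.1 - 1) *: u).
rewrite linearD linearZ /= px1 pu [RHS]surjective_pairing; congr pair.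
  by rewrite /= [_ *: _]mulr1 addrC subrK.
by rewrite /= scaler0 addr0.
Qed.

(** A difference with zero coordinates has eps = 0 and all rho = 0, and these are all its
restrictions of arity at most 1, so [small_restr_inj] applies. *)
Lemma coords_inj n : (forall k, ker_both P k.+1 = 0%VS) -> injective (coords n).
Proof.
move=> kb x x' /eqP; rewrite -subr_eq0 -linearB; set d := x - x' => /eqP; rewrite /= coordsE => pd.
apply/eqP; rewrite -subr_eq0 -/d; apply/eqP.
have e0 : eps d = 0 by have := congr1 fst pd.
have r0 j : rho d j = 0.
  rewrite rhoE e0 scale0r addr0; have := congr1 snd pd; rewrite /=.
  by move/ffunP/(_ j); rewrite !ffunE => ->; rewrite linear0.
apply: (small_restr_inj kb) => w wr; rewrite /= => t1.
(* A restriction of arity at most 1 keeps either no input or exactly one. *)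
have [j /eqP wj|w0] := pickP (fun j : 'I_n => tag (w j) == 1%N); last first.
  rewrite (_ : fcomp _ _ = scale_any 0 S0); first by rewrite /is_zero /= scale0r.
  rewrite -e0 -fcomp_S0; congr fcomp; apply/funext => i.
  by have [//|wi] := wr i; have := w0 i; rewrite wi.
rewrite (_ : fcomp _ _ = pack (rho d j)); first by rewrite /is_zero r0.
rewrite pack_rho; congr fcomp; apply/funext => i; rewrite /single.
have [->|ij] := eqVneq i j; first by have [wj0|//] := wr j; rewrite wj0 in wj.
have [//|wi] := wr i; move: t1.
by rewrite (bigD1 j)//= (bigD1 i)//= wj wi.
Qed.

End Operad.

Section Naturality.
Variables (P Q : operad2u K) (h : operad2u_hom P Q).

Definition oh_any (s : anyop P) : anyop Q := pack (h (tag s) (tagged s)).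

Lemma oh_fcomp n (x : P n) (y : 'I_n -> anyop P) :
  oh_any (fcomp x y) = fcomp (h n x) (fun i => oh_any (y i)).
Proof. by congr pack; exact: oh_comp. Qed.

Lemma oh_any_S0 : oh_any (S0 P) = S0 Q. Proof. by congr pack; exact: oh_0. Qed.

Lemma oh_any_S1 : oh_any (S1 P) = S1 Q. Proof. by congr pack; exact: oh_one. Qed.

Lemma eps_morph n (x : P n) : eps (h n x) = eps x.
Proof.
apply: epsP; have := congr1 oh_any (fcomp_S0 x).
rewrite oh_fcomp oh_any_S0 => ->.
by rewrite /oh_any /scale_any /= linearZ /= oh_0.
Qed.

Lemma rho_morph n (x : P n) j : rho (h n x) j = h 1%N (rho x j).
Proof.
apply: rhoP; have := congr1 oh_any (pack_rho x j); rewrite oh_fcomp => e.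
rewrite -[RHS]/(oh_any (pack (rho x j))) e; congr fcomp; apply/funext => i.
by rewrite /single; case: ifP; rewrite ?oh_any_S0 ?oh_any_S1.
Qed.

Lemma coords_natural :
  operad2u_comp (algop_hom (aug_hom h)) (coords_hom P) = operad2u_comp (coords_hom Q) h.
Proof.
apply: operad2u_hom_eq => n; apply/lfunP => x; rewrite !comp_lfunE /= algop_mapE !coordsE.
congr pair; first by rewrite /= eps_morph.
apply/ffunP => j; rewrite !ffunE; apply: subvs_inj.
by rewrite aug_lfunE !val_aug_part linearB linearZ /= oh_one rho_morph eps_morph.
Qed.

End Naturality.
End Restrictions.

(** * The equivalences of categories *)

Section Equivalence.
Variables (K : fieldType) (p : Op2uCat K -> Prop).
Hypothesis p_algop : forall A : fdalg K, p (algop A).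
Hypothesis p_ker : forall P : Op2uCat K, p P -> forall k, ker_both P k.+1 = 0%VS.

Lemma coords_iso (P : Op2uCat K) : p P ->
  is_iso (coords_hom P : hom P (algop (aug_alg P) : Op2uCat K)).
Proof.
move=> pP; apply: operad2u_iso => n; first exact/coords_inj/p_ker.
exact: coords_surj.
Qed.

(** Stated for a full subcategory so that it covers the 2-unitary and the
2a-unitary operads at once. *)
Lemma aug_equivalence : is_equivalence (functor_comp (aug_functor K) (full_incl p)).
Proof.
exists (algop_functor p_algop); split.
  apply: nat_isomorphic_sym.
  exists (fun X : full_sub p => coords_hom (sval X)); split=> [X Y f|X].
    exact: coords_natural.
  exact: coords_iso (svalP X).
exists (@aug_algop K); split=> [A B f|A]; last exact: aug_algop_iso.
apply: fdalg_hom_eq; apply/lfunP => x; rewrite !comp_lfunE /= !lfunE /=.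
by rewrite /aug_algop_fun vsprojK ?ffunE// mem_aug_algop /= aug_algop0.
Qed.

End Equivalence.

Section Associativity.
Variables (K : fieldType) (P : operad2u K).
Hypothesis kb : forall k, ker_both P k.+1 = 0%VS.

(** The associativity equation holds in the operad of the augmentation ideal, and
the coordinates are injective. *)
Lemma ker_both0_2a : is_2a_unitary P.
Proof.
pose f := coords_hom P.
have refl m n (x : P m) (y : P n) : heq (algop (aug_alg P)) (f m x) (f n y) -> heq P x y.
  move=> e; have mn : m = n by exact: (congr1 tag e).
  by case: _ / mn y e => y /heq_eq /(coords_inj kb) ->.
apply: refl; rewrite !oh_comp2 oh_2 oh_one.
exact: algop_2a.
Qed.

End Associativity.

Lemma full_incl_sub_equivalence (C : category) (p q : C -> Prop)
    (pq : forall X, p X -> q X) :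
  (forall X, q X -> p X) -> is_equivalence (full_incl_sub pq).
Proof.
move=> qp; exists (full_incl_sub qp).
split; exists (fun X => idm (sval X)); split=> [X Y f|X];
  do ?[by rewrite /= comp1m compm1]; by exists (idm (sval X)); rewrite /= compm1.
Qed.

Theorem theorem0p6 (K : fieldType) (R : realType) :
  [/\ is_equivalence (aug_2u K R : functor (Op2u_GK2 K R) (FdAlgCat K)),
      is_equivalence (aug_2a K R : functor (Op2a_GK2 K R) (FdAlgCat K)) &
      is_equivalence (forget_2a K R : functor (Op2a_GK2 K R) (Op2u_GK2 K R))].
Proof.
split.
- apply: aug_equivalence => [A|P]; first exact: GKdim_algop.
  exact: GK2_ker_both.
- apply: aug_equivalence => [A|P [_]]; last exact: GK2_ker_both.
  by split; [exact: algop_2a|exact: GKdim_algop].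
- apply: full_incl_sub_equivalence => P gk; split=> //.
  exact/ker_both0_2a/(GK2_ker_both gk).
Qed.
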